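(* Let $a>0$ and $x>0$, and let $T_x$ be the first passage time at level $x$ of a one-dimensional Brownian motion with constant drift $a$ started at $0$. Then $T_x$ is distributed as a generalized gamma convolution with Thorin measure $$\nu(dc)=\frac{dc}{\pi\sqrt{c-a^2/2}},\qquad c>a^2/2.$$
   Context: Brownian motion with drift $a$ started at $0$ is the process $(B_t+at)_{t\ge0}$ with $B$ a standard one-dimensional Brownian motion started at $0$, and $T_x=\inf\{t\ge 0: B_t+at=x\}$. Its distribution is $x\frac{e^{-x^2/(2t)}}{\sqrt{2\pi t^3}}e^{ax-a^2t/2}\,dt$ on $(0,\infty)$, with Laplace transform $E[e^{-\lambda^2T_x/2}]=e^{-x\sqrt{\lambda^2+a^2}+ax}$. For $\omega,c>0$, the gamma distribution $\Gamma_{\omega,c}$ is the probability distribution on $(0,\infty)$ with density $\frac{c^{\omega}}{\Gamma(\omega)}t^{\omega-1}e^{-ct}$; its Laplace transform is $\lambda\mapsto(1+\lambda/c)^{-\omega}$, and the Lévy exponent of the gamma convolution semigroup (with respect to the parameter $\omega$) is $\psi_c(\lambda)=\log(1+\lambda/c)=\int_0^\infty(1-e^{-\lambda t})\frac{e^{-ct}}{t}\,dt$. Generalized gamma convolutions are the distributions of linear combinations, with positive coefficients, of independent gamma variables, and their weak limits. They are also characterized as the infinitely divisible distributions with Laplace transform $E[e^{-\lambda X}]=e^{-\psi(\lambda)}$, where the Lévy exponent has the form $$\psi(\lambda)=\int_0^\infty\psi_c(\lambda)\,\nu(dc)$$ for some positive measure $\nu$ which integrates $1/c$ at $\infty$.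 The measure $\nu$ is called the Thorin measure of the distribution. In the claim, $\nu$ is carried by $(a^2/2,\infty)$.
   Formalization: The Thorin measure of T_x is taken to be (x/√2)·dc/(π√(c-a²/2)) on c>a²/2; the displayed measure, which does not depend on x, is correct only for x=√2. *)

(* Defs.v *)
From HB Require Import structures.
From mathcomp Require Import all_boot all_order all_algebra.
From mathcomp Require Import all_classical all_reals all_analysis measurable_realfun.

Set Implicit Arguments.
Unset Strict Implicit.
Unset Printing Implicit Defensive.

Import Order.TTheory GRing.Theory Num.Theory.
Import numFieldNormedType.Exports.

Local Open Scope classical_set_scope.
Local Open Scope ring_scope.

Definition has_law (R : realType) (d d' : measure_display)
    (T : measurableType d) (T' : measurableType d') (P : probability T R)
    (X : T -> T') (m : set T' -> \bar R) : Prop :=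
  measurable_fun setT X /\
  forall A : set T', measurable A -> P (X @^-1` A) = m A.

(* Since the [A i] may be [setT], the product rule over the whole index set
   entails the product rule over every subfamily. *)
Definition mutually_independent (R : realType) (d : measure_display)
    (T : measurableType d) (P : probability T R) (n : nat)
    (X : 'I_n -> T -> R) : Prop :=
  forall A : 'I_n -> set R, (forall i, measurable (A i)) ->
    P (\bigcap_(i in [set: 'I_n]) (X i @^-1` A i)) =
    (\prod_(i < n) P (X i @^-1` A i))%E.

(* [B t] is constrained for [0 <= t] only; [normal_prob] takes the standard
   deviation as its second argument. *)
Definition standard_brownian_motion (R : realType) (d : measure_display)
    (T : measurableType d) (P : probability T R) (B : R -> {RV P >-> R}) : Prop :=
  [/\ forall w, B 0 w = 0,
      forall w, {within `[0, +oo[, continuous (fun t : R => B t w)},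
      forall s t : R, 0 <= s -> s < t ->
        has_law P (B t \- B s) (normal_prob 0 (Num.sqrt (t - s)))
    & forall (n : nat) (t : nat -> R),
        0 <= t 0%N -> (forall i, t i <= t i.+1) ->
        mutually_independent P (fun i : 'I_n => B (t i.+1) \- B (t i)) ].

(* Equal to [+oo] on the paths that never reach the level [x]. *)
Definition first_passage_time (R : realType) (d : measure_display)
    (T : measurableType d) (P : probability T R) (B : R -> {RV P >-> R})
    (a x : R) (w : T) : \bar R :=
  ereal_inf [set t%:E | t in [set t : R | 0 <= t /\ B t w + a * t = x]].

Definition Gamma_fun (R : realType) (omega : R) : R :=
  \int[lebesgue_measure]_(t in `]0, +oo[) (t `^ (omega - 1) * expR (- t)).

Definition gamma_pdf (R : realType) (omega c t : R) : R :=
  c `^ omega / Gamma_fun omega * t `^ (omega - 1) * expR (- (c * t)).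

Definition gamma_law (R : realType) (omega c : R) (A : set R) : \bar R :=
  (\int[lebesgue_measure]_(t in A `&` `]0%R, +oo[) (gamma_pdf omega c t)%:E)%E.

Definition finite_gamma_convolution (R : realType) (mu : probability R R) : Prop :=
  exists (n : nat) (d : measure_display) (T : measurableType d)
         (P : probability T R) (X : 'I_n.+1 -> {RV P >-> R})
         (k omega c : 'I_n.+1 -> R),
    [/\ forall i, [/\ 0 < k i, 0 < omega i & 0 < c i],
        mutually_independent P (fun i => X i),
        forall i, has_law P (X i) (gamma_law (omega i) (c i))
      & has_law P (fun w => \sum_(i < n.+1) k i * X i w) mu].

Definition weakly_converges (R : realType) (mu_ : nat -> probability R R)
    (mu : probability R R) : Prop :=
  forall f : R -> R, continuous f -> (exists M : R, forall x, `|f x| <= M) ->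
    (\int[mu_ n]_x f x) @[n --> \oo] --> \int[mu]_x f x.

Definition generalized_gamma_convolution (R : realType)
    (mu : probability R R) : Prop :=
  exists mu_ : nat -> probability R R,
    (forall n, finite_gamma_convolution (mu_ n)) /\ weakly_converges mu_ mu.

Definition infinitely_divisible (R : realType) (mu : probability R R) : Prop :=
  forall n : nat,
  exists (d : measure_display) (T : measurableType d) (P : probability T R)
         (X : 'I_n.+1 -> {RV P >-> R}),
    [/\ mutually_independent P (fun i => X i),
        forall i j, has_law P (X i) (distribution P (X j))
      & has_law P (fun w => \sum_(i < n.+1) X i w) mu].

Definition laplace_transform (R : realType) (mu : probability R R)
    (lambda : R) : \bar R :=
  (\int[mu]_t (expR (- (lambda * t)))%:E)%E.

Definition gamma_levy_exponent (R : realType) (c lambda : R) : R :=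
  ln (1 + lambda / c).

Definition thorin_levy_exponent (R : realType)
    (nu : {measure set R -> \bar R}) (lambda : R) : \bar R :=
  (\int[nu]_(c in `]0%R, +oo[) (gamma_levy_exponent c lambda)%:E)%E.

(* The positive measure [nu] on (0, oo) is seen as a measure on the line that
   does not charge (-oo, 0]. *)
Definition is_thorin_measure (R : realType) (mu : probability R R)
    (nu : {measure set R -> \bar R}) : Prop :=
  [/\ nu `]-oo, 0]%classic = 0%E,
      forall M : R, 0 < M -> (\int[nu]_(c in `[M, +oo[) (c^-1)%:E < +oo)%E,
      infinitely_divisible mu
    & forall lambda : R, 0 <= lambda ->
        laplace_transform mu lambda =
        expeR (- thorin_levy_exponent nu lambda)%E].

Definition ggc_with_thorin_measure (R : realType) (mu : probability R R)
    (nu : {measure set R -> \bar R}) : Prop :=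
  generalized_gamma_convolution mu /\ is_thorin_measure mu nu.

(* Integrating [psi_c (lambda) = ln (1 + lambda / c)] against [passage_nu a]
   gives [sqrt 2 * (sqrt (2 lambda + a^2) - a)], whereas the Levy exponent of
   the first passage time at level [x] is [x * (sqrt (2 lambda + a^2) - a)]:
   the Thorin measure of the latter is [passage_nu a] scaled by [x / sqrt 2]. *)
Section passage_nu.
Context {R : realType} (a : R).

Definition passage_nu_density (c : R) : R :=
  (pi * Num.sqrt (c - a ^+ 2 / 2))^-1.

Definition passage_nu (A : set R) : \bar R :=
  (\int[lebesgue_measure]_(c in A `&` `](a ^+ 2 / 2)%R, +oo[)
     (passage_nu_density c)%:E)%E.

Let density_ge0 c : 0 <= passage_nu_density c.
Proof. by rewrite invr_ge0 mulr_ge0 ?pi_ge0 ?sqrtr_ge0. Qed.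

Let measurable_density :
  measurable_fun `](a ^+ 2 / 2), +oo[ passage_nu_density.
Proof.
apply: open_continuous_measurable_fun; first exact: interval_open.
move=> c; rewrite inE/= in_itv/= andbT => ac.
rewrite /passage_nu_density; apply: cvgV.
  by rewrite mulf_neq0 ?gt_eqF ?pi_gt0 ?sqrtr_gt0 ?subr_gt0.
apply: cvgM; first exact: cvg_cst.
apply: (cvg_comp (fun c => c - a ^+ 2 / 2) Num.sqrt).
  by apply: cvgB; [exact: cvg_id|exact: cvg_cst].
exact: sqrt_continuous.
Qed.

Let passage_nu0 : passage_nu set0 = 0%E.
Proof. by rewrite /passage_nu set0I integral_set0. Qed.

Let passage_nu_ge0 A : (0 <= passage_nu A)%E.
Proof. by apply: integral_ge0 => c _; rewrite lee_fin. Qed.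

Let passage_nu_sigma_additive : semi_sigma_additive passage_nu.
Proof.
move=> /= A mA tA mUA; rewrite /passage_nu setI_bigcupl.
rewrite ge0_integral_bigcup//=; last 4 first.
- by move=> n; apply: (measurableI _ _ (mA n)).
- apply: (measurable_funS (E := `](a ^+ 2 / 2), +oo[)) => //; last first.
    exact: (measurableT_comp (f := @EFin R)).
  by apply: bigcup_sub => n _; exact: subIsetr.
- by move=> c _; rewrite lee_fin.
- exact: trivIset_setIr.
apply: is_cvg_ereal_nneg_natsum_cond => n _ _; exact: passage_nu_ge0.
Qed.

HB.instance Definition _ := isMeasure.Build _ R R passage_nu
  passage_nu0 passage_nu_ge0 passage_nu_sigma_additive.

End passage_nu.

(* Main.v *)
(** The process [exp (theta X_t - lambda t)], with [X_t = B_t + a t] and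
    [lambda = theta a + theta ^ 2 / 2], is a martingale. Stopping the walk
    sampled with mesh [h] at its first step above [y], and letting [h -> 0],
    gives [E exp (- lambda T_x) = exp (- theta x)], that is, the Levy exponent
    [x (sqrt (2 lambda + a ^ 2) - a)].

    The substitution [c = a ^ 2 / 2 + u ^ 2] turns the Thorin integral into
    that of [ln ((be ^ 2 + u ^ 2) / (al ^ 2 + u ^ 2))] over [u > 0], with
    [al ^ 2 = a ^ 2 / 2] and [be ^ 2 = al ^ 2 + lambda], which has an explicit
    primitive. The Riemann sums of this integral are the Levy exponents of
    finite gamma convolutions, so that these converge weakly to the law of
    [T_x], by the continuity theorem for Laplace transforms (a consequence of
    the Weierstrass theorem on [0, 1] after the change of variable
    [t -> exp (- t)]). Infinite divisibility holds because the exponent is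
    linear in [x] and a Laplace transform determines the law. *)
Require Import Defs.
From HB Require Import structures.
From mathcomp Require Import all_boot all_order all_algebra.
From mathcomp Require Import all_classical all_reals all_analysis measurable_realfun.
From mathcomp Require Import ring lra.
Import Order.TTheory GRing.Theory Num.Theory.
Import numFieldNormedType.Exports.
Local Open Scope classical_set_scope.
Local Open Scope ring_scope.
Set Implicit Arguments.
Unset Strict Implicit.
Unset Printing Implicit Defensive.

(** * Laplace transforms and weak convergence *)

(** The law of the passage time is reached through its Laplace transform alone; its density never
    appears. The obstacle is the overshoot: the sampled walk jumps over the level, so the stopped
    martingale is not constant at the hit. For an upper bound on the discounted hit, the overshoot
    has the favourable sign. For a lower bound it must be small: mesh [p ^ -2], [p ^ 3] steps and
    Chernoff parameter [p] are balanced so that all possible overshoots together have negligible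
    weight while the horizon [p] grows. The comparison with the path is one-sided too: the walk
    passes [x] after the path does, and a path that barely touches [x] may be missed by every
    sample, so the reverse inequality goes through a level [y < x] and Fatou's lemma. Almost sure
    finiteness of the passage time is itself read off the transform, as [theta] tends to 0. On the
    analytic side, a bounded continuous function of [t] need not extend continuously to
    [exp (- t) = 0]; a cutoff near 0 repairs this, and the convergence of the integrals of the
    cutoff itself provides tightness. *)

Section weierstrass.
Context {R : realType}.
Implicit Types (f : R -> R) (g : nat -> R) (u : R).

(* [bernstein n g] has value [E (g S)] at [u], where [S] is the number of
   successes in [n] independent trials of probability [u]. *)
Fixpoint bernstein n g : {poly R} :=
  if n is n'.+1 then 'X * bernstein n' (g \o S) + (1 - 'X) * bernstein n' g
  else (g 0%N)%:P.

Lemma bernsteinS n g u : (bernstein n.+1 g).[u] =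
  u * (bernstein n (g \o S)).[u] + (1 - u) * (bernstein n g).[u].
Proof. by rewrite /= !hornerE. Qed.

Lemma bernstein_affine n g u (b c : R) :
  (bernstein n (fun k => b + c * g k)).[u] = b + c * (bernstein n g).[u].
Proof.
elim: n g => [|n IH] g; first by rewrite /= !hornerC.
rewrite !bernsteinS IH.
have -> : bernstein n ((fun k => b + c * g k) \o S) =
  bernstein n (fun k => b + c * (g \o S) k) by [].
by rewrite IH; ring.
Qed.

(** Second moment of an affine function of a binomial variable: squared mean plus variance. The
    offset [b] is general because conditioning on the first trial shifts it by [c]. *)
Lemma bernstein_sqr n u (b c : R) :
  (bernstein n (fun k => (b + c * k%:R) ^+ 2)).[u] =
  (b + c * n%:R * u) ^+ 2 + c ^+ 2 * n%:R * (u * (1 - u)).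
Proof.
elim: n b => [|n IH] b; first by rewrite /= !hornerC !(mulr0, mul0r, addr0).
rewrite bernsteinS IH.
have -> : bernstein n ((fun k : nat => (b + c * k%:R) ^+ 2) \o S) =
          bernstein n (fun k : nat => ((b + c) + c * k%:R) ^+ 2).
  by congr bernstein; apply/funext => k /=; rewrite -natr1; ring.
by rewrite IH -natr1; ring.
Qed.

(** Positivity of the operator: for [u] in [0, 1] each step of the recursion is a convex
    combination. *)
Lemma ler_norm_bernstein n g (h : nat -> R) u : 0 <= u <= 1 ->
    (forall k, (k <= n)%N -> `|g k| <= h k) ->
  `|(bernstein n g).[u]| <= (bernstein n h).[u].
Proof.
move=> /andP[u0 u1]; elim: n g h => [|n IH] g h gh.
  by rewrite /= !hornerC gh.
rewrite !bernsteinS (le_trans (ler_normD _ _))// lerD// normrM.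
  by rewrite ger0_norm// ler_wpM2l// IH// => k kn; exact: gh.
rewrite ger0_norm ?subr_ge0// ler_wpM2l ?subr_ge0// IH// => k kn.
by apply: gh; exact: leqW.
Qed.

(** Compactness of [0, 1] in its near-covering form. Continuity at the points of the interval is
    two-sided, so [v] may leave it. *)
Lemma uniform_continuity_itv01 f (e : R) :
    (forall x, 0 <= x <= 1 -> {for x, continuous f}) -> 0 < e ->
  exists2 delta : R, 0 < delta &
    forall u v, 0 <= u <= 1 -> `|u - v| < delta -> `|f u - f v| < e.
Proof.
move=> cf e0.
have := @segment_compact R 0 1 => /compact_near_coveringP.
move=> /(_ R (0 : R)^'+ (fun del x => forall v, `|x - v| < del -> `|f x - f v| < e)) H.
have {}H := H _ _.
have : \forall del \near (0 : R)^'+, `[0, 1] `<=`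
    (fun x => forall v, `|x - v| < del -> `|f x - f v| < e).
  apply: H => x /=; rewrite in_itv/= => x01.
  have /cvgrPdist_lt/(_ _ (divr_gt0 e0 (ltr0n R 2)))[r/= r0 Hr] := cf x x01.
  have r20 : 0 < r / 2 by rewrite divr_gt0.
  exists (ball x (r / 2), [set del | del < r / 2]) => /=.
    by split; [exact: nbhsx_ballx|exact: nbhs_right_lt].
  move=> [x' del] /= [xx' dr] v x'v.
  have H1 : `|x - x'| < r / 2 by exact: xx'.
  have H2 : `|x - v| < r.
    rewrite -(subrKA x') (le_lt_trans (ler_normD _ _))// (splitr r) ltrD//.
    exact: lt_trans dr.
  have := Hr v H2; have : `|f x - f x'| < e / 2.
    by apply: Hr; apply: lt_trans H1 _; rewrite ltr_pdivrMr// ltr_pMr// ltr1n.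
  move=> h1 h2; rewrite -(subrKA (f x)) (le_lt_trans (ler_normD _ _))//.
  by rewrite (splitr e) ltrD// distrC.
move=> [r /= r0 Hr]; exists (r / 2); first by rewrite divr_gt0.
move=> u v u01; apply: (Hr (r / 2)) => //=.
- by rewrite sub0r normrN gtr0_norm ?divr_gt0// ltr_pdivrMr// ltr_pMr// ltr1n.
- by rewrite divr_gt0.
Qed.

Lemma weierstrass_itv01 f (M e : R) :
    (forall x, 0 <= x <= 1 -> {for x, continuous f}) ->
    (forall x, `|f x| <= M) -> 0 < e ->
  exists p : {poly R}, forall u, 0 <= u <= 1 -> `|f u - p.[u]| <= e.
Proof.
move=> cf fM e0.
have e20 : 0 < e / 2 by rewrite divr_gt0.
have [del del0 Hdel] := uniform_continuity_itv01 cf e20.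
have M0 : 0 <= M by apply: le_trans (fM 0).
pose C := 2 * M / del ^+ 2.
have C0 : 0 <= C by rewrite divr_ge0 ?exprn_ge0 ?mulr_ge0// ltW.
(* Bernstein's device: at distance at least [del] the trivial bound [2 * M] is absorbed by a
   multiple of the squared distance, whose mean is a binomial variance. *)
have HC u v : 0 <= u <= 1 -> `|f u - f v| <= e / 2 + C * (v - u) ^+ 2.
  move=> u01; have [uv|uv] := ltP `|u - v| del.
    by rewrite (le_trans (ltW (Hdel _ _ u01 uv)))// lerDl mulr_ge0 ?sqr_ge0.
  rewrite -[leLHS]add0r lerD ?(ltW e20)//.
  apply: (@le_trans _ _ (2 * M)).
    by rewrite (le_trans (ler_normB _ _))// mulrDl mul1r lerD.
  rewrite /C mulrAC -mulrA ler_peMr ?mulr_ge0//.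
  rewrite ler_pdivlMr ?exprn_gt0// mul1r -[leRHS]real_normK ?num_real//.
  by rewrite lerXn2r ?nnegrE ?(ltW del0)// distrC.
(* The variance term is at most [C / n], and this choice makes it at most [e / 2]. *)
pose n := (Num.truncn (2 * C / e)).+1.
have n0 : 0 < n%:R :> R by rewrite ltr0n.
exists (bernstein n (fun k => f (k%:R / n%:R))) => u u01.
have -> : f u - (bernstein n (fun k => f (k%:R / n%:R))).[u] =
   (bernstein n (fun k => f u + (-1) * f (k%:R / n%:R))).[u].
  by rewrite bernstein_affine mulN1r.
have := @ler_norm_bernstein n (fun k => f u + (-1) * f (k%:R / n%:R))
   (fun k => e / 2 + C * ((- u + n%:R^-1 * k%:R) ^+ 2)) u u01.
move=> /(_ _)/le_trans; apply.
  by move=> k _; rewrite mulN1r (addrC (- u)) (mulrC n%:R^-1); exact: HC.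
rewrite bernstein_affine bernstein_sqr mulVf ?gt_eqF// mul1r addNr expr0n/= add0r.
rewrite [leRHS](splitr e) lerD2l.
have -> : C * (n%:R^-1 ^+ 2 * n%:R * (u * (1 - u))) = C / n%:R * (u * (1 - u)).
  by field; rewrite gt_eqF.
case/andP: (u01) => u0 u1.
apply: (@le_trans _ _ (C / n%:R)).
  have Cn0 : 0 <= C / n%:R by apply: divr_ge0 => //; exact: ltW.
  by apply: ler_piMr => //; apply: mulr_ile1; rewrite ?subr_ge0// gerBl.
rewrite ler_pdivrMr// mulrAC ler_pdivlMr// mulrC -ler_pdivrMl//.
have nC : 2 * C / e < n%:R by exact: truncnS_gt.
by apply: le_trans (ltW nC); rewrite [leRHS]mulrC.
Qed.

End weierstrass.

Section bounded_integrals.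
Context {R : realType} {d : measure_display} {T : measurableType d}.
Variable mu : probability T R.

Lemma bounded_integrable (f : T -> R) (M : R) : measurable_fun setT f ->
  (forall x, `|f x| <= M) -> mu.-integrable setT (EFin \o f).
Proof.
move=> mf fM; apply: (@le_integrable _ _ _ mu setT measurableT _ (cst M%:E)).
- exact/measurable_EFinP.
- by move=> x _ /=; rewrite lee_fin (le_trans (fM x))// ler_norm.
- exact: finite_measure_integrable_cst.
Qed.

Lemma ler_norm_RintegralB (f g h : T -> R) (M : R) :
    measurable_fun setT f -> measurable_fun setT g -> measurable_fun setT h ->
    (forall x, `|f x| <= M) -> (forall x, `|g x| <= M) -> (forall x, `|h x| <= M) ->
    (forall x, `|f x - g x| <= h x) ->
  `|(\int[mu]_x f x) - (\int[mu]_x g x)| <= \int[mu]_x h x.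
Proof.
move=> mf mg mh fM gM hM fgh.
have If := bounded_integrable mf fM.
have Ig := bounded_integrable mg gM.
have Ih := bounded_integrable mh hM.
rewrite -RintegralB//.
have Ifg : mu.-integrable setT (EFin \o (fun x => f x - g x)).
  apply: (@bounded_integrable _ (M + M)); first exact: measurable_funB.
  by move=> x; rewrite (le_trans (ler_normB _ _))// lerD.
apply: (le_trans (le_normr_Rintegral measurableT Ifg)).
apply: le_Rintegral => //.
apply: (@bounded_integrable _ (M + M)).
  by apply: measurableT_comp => //; exact: measurable_funB.
by move=> x; rewrite normr_id (le_trans (ler_normB _ _))// lerD.
Qed.

Lemma Rintegral_cst_prob (c : R) : \int[mu]_x c = c.
Proof.
rewrite Rintegral_cst// -[RHS]mulr1; congr (_ * _).
by apply: (@EFin_inj R); rewrite fineK ?fin_num_measure//; exact: probability_setT.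
Qed.

End bounded_integrals.

(** * Continuity theorem for Laplace transforms on the half-line *)

Section laplace_continuity.
Context {R : realType}.
Implicit Types (mu : probability R R) (f : R -> R).

(** Truncated at 0 so as to map the whole line into ]0, 1]; measures without mass on the negative
    half-line do not see the truncation. Integrals of its powers are the Laplace transforms at the
    integers. *)
Let phi (t : R) : R := expR (- Num.max t 0).

Let phi_gt0 t : 0 < phi t. Proof. exact: expR_gt0. Qed.

Let phi_le1 t : phi t <= 1.
Proof. by rewrite -expR0 ler_expR oppr_le0 le_max lexx orbT. Qed.

Let phi01 t : 0 <= phi t <= 1.
Proof. by rewrite phi_le1 ltW. Qed.

Let measurable_phi : measurable_fun setT phi.
Proof.
apply: measurableT_comp => //; apply: measurableT_comp => //.
exact: measurable_maxr.
Qed.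

Let phiM (c : R) i t : `|c * phi t ^+ i| <= `|c|.
Proof.
rewrite normrM ler_piMr// normrX ger0_norm ?(ltW (phi_gt0 t))//.
by rewrite exprn_ile1// ltW.
Qed.

Let measurable_horner_phi (p : {poly R}) : measurable_fun setT (fun t => p.[phi t]).
Proof.
rewrite (_ : (fun t => _) = fun t => \sum_(i < size p) p`_i * phi t ^+ i).
  apply: measurable_sum => i; apply: measurable_funM => //.
  exact: measurable_funX.
by apply/funext => t; rewrite horner_coef.
Qed.

Let horner_phi_bounded (p : {poly R}) : exists M, forall t, `|p.[phi t]| <= M.
Proof.
exists (\sum_(i < size p) `|p`_i|) => t.
rewrite horner_coef (le_trans (ler_norm_sum _ _ _))//; apply: ler_sum => i _.
exact: phiM.
Qed.

Let Rintegral_nonneg mu f : mu `]-oo, 0[%classic = 0%E ->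
  measurable_fun setT f ->
  \int[mu]_t f t = \int[mu]_t f (Num.max t 0).
Proof.
move=> mu0 mf; congr fine; apply: ae_eq_integral => //.
- exact/measurable_EFinP.
- apply/measurable_EFinP; apply: (measurableT_comp mf); exact: measurable_maxr.
exists `]-oo, 0[%classic; split => // t /= H; rewrite in_itv/= ltNge.
apply/negP => t0; apply: H => _; rewrite max_l//.
Qed.

Let Rintegral_phi mu i : mu `]-oo, 0[%classic = 0%E ->
  \int[mu]_t (phi t ^+ i) = fine (laplace_transform mu i%:R).
Proof.
move=> mu0; rewrite /laplace_transform.
have := @Rintegral_nonneg mu (fun t => expR (- (i%:R * t))) mu0.
rewrite {1}/Rintegral => ->; last first.
  by apply: measurableT_comp => //; apply: measurableT_comp.
apply: eq_Rintegral => t _.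
by rewrite /phi -expRM_natl mulrN.
Qed.

Let Rintegral_horner_phi mu (p : {poly R}) : mu `]-oo, 0[%classic = 0%E ->
  \int[mu]_t p.[phi t] =
  \sum_(i < size p) p`_i * fine (laplace_transform mu i%:R).
Proof.
move=> mu0.
have Ii i : mu.-integrable setT (EFin \o (fun t => phi t ^+ i)).
  apply: (@bounded_integrable _ _ _ _ _ 1); first exact: measurable_funX.
  by move=> t; rewrite normrX ger0_norm ?(ltW (phi_gt0 t))// exprn_ile1// ltW.
transitivity (\int[mu]_t \sum_(i < size p) p`_i * phi t ^+ i).
  by apply: eq_Rintegral => t _; rewrite horner_coef.
elim: (size p) => [|k IH].
  under eq_Rintegral do rewrite big_ord0.
  by rewrite Rintegral_cst_prob big_ord0.
under eq_Rintegral do rewrite big_ord_recr/=.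
rewrite RintegralD//; last 2 first.
- apply: (@bounded_integrable _ _ _ _ _ (\sum_(i < k) `|p`_i|)).
    apply: measurable_sum => i; apply: measurable_funM => //.
    exact: measurable_funX.
  move=> t; rewrite (le_trans (ler_norm_sum _ _ _))//; apply: ler_sum => i _.
  exact: phiM.
- apply: (@bounded_integrable _ _ _ _ _ (`|p`_k|)) => [|t]; last exact: phiM.
  by apply: measurable_funM => //; exact: measurable_funX.
by rewrite IH big_ord_recr/= RintegralZl// Rintegral_phi.
Qed.

(** A bounded [f] may oscillate at infinity, where [u = phi t] tends to 0. The cutoff vanishes at 0
    and equals 1 as soon as [u] reaches [del], so that [cutln] is continuous on [0, 1]. *)
Let cut (del : R) (u : R) : R := Num.min 1 (`|u| / del).

Let cut01 (del u : R) : 0 < del -> 0 <= cut del u <= 1.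
Proof. by move=> d0; rewrite /cut le_min ge_min lexx ler01 divr_ge0// ltW. Qed.

Let cut_continuous del : continuous (cut del).
Proof.
move=> u; apply: (@continuous_min _ _ (cst 1 : R -> R^o) (fun u : R => `|u| / del : R^o) u).
  exact: cvg_cst.
apply: cvgM; last exact: cvg_cst.
exact: norm_continuous.
Qed.

Let cutln f (del u : R) : R := f (- ln u) * cut del u.

Let cutln_continuous f (del M : R) : 0 < del -> continuous f -> (forall x, `|f x| <= M) ->
  forall u, 0 <= u <= 1 -> {for u, continuous (cutln f del)}.
Proof.
move=> del0 cf fM u /andP[u0 u1].
have M0 : 0 <= M by apply: le_trans (fM 0).
have [->|un0] := eqVneq u 0; last first.
  have ugt : 0 < u by rewrite lt_neqAle eq_sym un0.
  apply: cvgM; last exact: cut_continuous.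
  apply: (cvg_comp (fun v => - ln v) f); last exact: cf.
  by apply: cvgN; apply: continuous_ln.
(* At 0 the factor [f (- ln v)] is merely bounded, which also covers the default values of [ln] at
   nonpositive [v]; the linear decay of [cut] is enough. *)
apply/cvgrPdist_lt => e e0.
have r0 : 0 < e * del / (M + 1) by rewrite divr_gt0 ?mulr_gt0 ?ltr_wpDl.
exists (e * del / (M + 1)) => //= v; rewrite /ball_/= sub0r normrN => vr.
rewrite {1}/cutln /cut normr0 mul0r min_r// mulr0 sub0r normrN.
have /andP[c0 c1] := cut01 v del0.
rewrite /cutln normrM [`|cut del v|]ger0_norm//.
apply: (@le_lt_trans _ _ ((M + 1) * (`|v| / del))).
  rewrite ler_pM//; first by rewrite (le_trans (fM _))// lerDl.
  by rewrite /cut ge_min lexx orbT.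
by rewrite mulrA ltr_pdivrMr// mulrC -ltr_pdivlMr ?ltr_wpDl.
Qed.

(** Tightness is not assumed: the mass that the cutoff removes from [mu_ n] converges to the one it
    removes from [mu], because the cutoff is itself a continuous function of [phi]. *)
Lemma laplace_weakly_converges (mu_ : nat -> probability R R) mu :
    mu `]-oo, 0[%classic = 0%E -> (forall n, mu_ n `]-oo, 0[%classic = 0%E) ->
    (forall i : nat, fine (laplace_transform (mu_ n) i%:R) @[n --> \oo] -->
                     fine (laplace_transform mu i%:R)) ->
  weakly_converges mu_ mu.
Proof.
move=> mu0 mun0 HL f cf [M0 fM0].
pose M := Num.max M0 1.
have fM x : `|f x| <= M by rewrite le_max fM0.
have M1 : 1 <= M by rewrite le_max lexx orbT.
have Mgt : 0 < M by exact: lt_le_trans M1.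
have Hsum (p : {poly R}) k :
    (fun n => \sum_(i < k) p`_i * fine (laplace_transform (mu_ n) i%:R)) @ \oo -->
    \sum_(i < k) p`_i * fine (laplace_transform mu i%:R).
  elim: k => [|k IH].
    have -> : (fun n => \sum_(i < 0) p`_i * fine (laplace_transform (mu_ n) i%:R)) =
              cst 0 by apply/funext => n; rewrite big_ord0.
    by rewrite big_ord0; exact: cvg_cst.
  have -> : (fun n => \sum_(i < k.+1) p`_i * fine (laplace_transform (mu_ n) i%:R)) =
      fun n => \sum_(i < k) p`_i * fine (laplace_transform (mu_ n) i%:R) +
      p`_k * fine (laplace_transform (mu_ n) k%:R).
    by apply/funext => n; rewrite big_ord_recr.
  rewrite big_ord_recr/=; apply: (cvgD IH).
  by apply: cvgM; [exact: cvg_cst|exact: HL].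
have Hpoly (p : {poly R}) :
    (fun n => \int[mu_ n]_t p.[phi t]) @ \oo --> \int[mu]_t p.[phi t].
  rewrite Rintegral_horner_phi//.
  have -> : (fun n => \int[mu_ n]_t p.[phi t]) =
     fun n => \sum_(i < size p) p`_i * fine (laplace_transform (mu_ n) i%:R).
    by apply/funext => n; exact: Rintegral_horner_phi.
  exact: Hsum.
have mf : measurable_fun setT f by exact: continuous_measurable_fun.
have mcut (g : R -> R) (del : R) : continuous g ->
    measurable_fun setT (fun t => cutln g del (phi t)).
  move=> cg; apply: measurable_funM.
    apply: (measurableT_comp (continuous_measurable_fun cg)).
    by apply: measurableT_comp => //; apply: measurableT_comp => //.
  by apply: (measurableT_comp (continuous_measurable_fun (@cut_continuous del))).
have cutM (g : R -> R) (del N t : R) : 0 < del -> (forall x, `|g x| <= N) ->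
    `|cutln g del (phi t)| <= N.
  move=> d0 gN; rewrite /cutln normrM (le_trans _ (gN (- ln (phi t))))//.
  have /andP[c0 c1] := cut01 (phi t) d0.
  by rewrite ler_piMr// ger0_norm.
have Hcut (g : R -> R) (del N : R) : 0 < del -> continuous g -> (forall x, `|g x| <= N) ->
    \int[mu_ n]_t cutln g del (phi t) @[n --> \oo] --> \int[mu]_t cutln g del (phi t).
  move=> del0 cg gN; apply/cvgrPdist_le => e e0.
  have e30 : 0 < e / 3 by rewrite divr_gt0.
  have N0 : 0 <= N by apply: le_trans (gN 0).
  have CM u : `|cutln g del u| <= N.
    rewrite /cutln normrM (le_trans _ (gN (- ln u)))//.
    have /andP[c0 c1] := cut01 u del0.
    by rewrite ler_piMr// ger0_norm.
  have [p Hp] := weierstrass_itv01 (cutln_continuous del0 cg gN) CM e30.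
  have [N' pN'] := horner_phi_bounded p.
  have close (nu : probability R R) : nu `]-oo, 0[%classic = 0%E ->
      `|\int[nu]_t cutln g del (phi t) - \int[nu]_t p.[phi t]| <= e / 3.
    move=> nu0; rewrite -[leRHS](Rintegral_cst_prob nu).
    pose K := Num.max N (Num.max N' (e / 3)).
    apply: (@ler_norm_RintegralB _ _ _ nu _ _ _ K) => //.
    - exact: mcut.
    - by move=> t; rewrite le_max (cutM g del N).
    - by move=> t; rewrite !le_max pN' orbT.
    - by move=> t; rewrite !le_max ger0_norm ?(ltW e30)// lexx !orbT.
    - by move=> t; exact: Hp.
  have /cvgrPdist_le/(_ _ e30) := Hpoly p; apply: filterS => n Hn.
  rewrite -(subrKA (\int[mu]_t p.[phi t])) (le_trans (ler_normD _ _))//.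
  have -> : e = e / 3 + (e / 3 + e / 3) by field.
  rewrite lerD ?close//.
  rewrite -(subrKA (\int[mu_ n]_t p.[phi t])) (le_trans (ler_normD _ _))//.
  by rewrite lerD// distrC close.
apply/cvgrPdist_le => e e0.
(* Sharing of [e]: one quarter for the tail of [mu], one for the difference of the cut integrals,
   two for the tail of [mu_ n]. *)
pose e' := e / (4 * M).
have e'0 : 0 < e' by rewrite divr_gt0// mulr_gt0.
(* Since [phi] is positive everywhere, the cutoffs tend to 1 pointwise as their width shrinks;
   dominated convergence does the rest. *)
have [k Hk] : exists k : nat,
    1 - e' <= \int[mu]_t cut k.+1%:R^-1 (phi t).
  have H : \int[mu]_t cut k.+1%:R^-1 (phi t) @[k --> \oo] --> (1 : R).
    rewrite -[X in _ --> X](Rintegral_cst_prob mu).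
    apply: fine_cvg; rewrite fineK; last first.
      rewrite integral_cst// mul1e; exact: fin_num_measure.
    have [|||||_ _ H] := @dominated_convergence _ _ _ mu setT measurableT
      (fun k t => (cut k.+1%:R^-1 (phi t))%:E) (cst 1%E) (cst 1%E).
    - move=> n; apply/measurable_EFinP.
      exact: (measurableT_comp (continuous_measurable_fun (@cut_continuous _))).
    - exact: measurable_cst.
    - apply: aeW => t _; apply: cvg_near_cst.
      exists (Num.truncn (phi t)^-1) => // n /= Hn.
      rewrite /cut min_l// invrK ger0_norm ?(ltW (phi_gt0 _))//.
      rewrite -ler_pdivrMl// mulr1 ltW// (lt_le_trans (truncnS_gt _))//.
      by rewrite ler_nat ltnS.
    - exact: finite_measure_integrable_cst.
    - apply: aeW => t n _ /=; rewrite lee_fin.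
      have n0 : 0 < n.+1%:R^-1 :> R by rewrite invr_gt0.
      have /andP[c0 c1] := cut01 (phi t) n0.
      by rewrite ger0_norm.
    exact: H.
  have /cvgrPdist_le/(_ _ e'0)[k _ Hk] := H.
  exists k; have := Hk k (leqnn k).
  by rewrite ler_distlC => /andP[].
set del := k.+1%:R^-1 in Hk.
have del0 : 0 < del by rewrite invr_gt0.
have mcut1 : measurable_fun setT (fun t => cut del (phi t)).
  exact: (measurableT_comp (continuous_measurable_fun (@cut_continuous _))).
have cut1E (nu : probability R R) : \int[nu]_t cutln (cst 1) del (phi t) = \int[nu]_t cut del (phi t).
  by apply: eq_Rintegral => t _; rewrite /cutln mul1r.
have cutn t : `|cut del (phi t)| <= 1.
  by have /andP[c0 c1] := cut01 (phi t) del0; rewrite ger0_norm.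
have close (nu : probability R R) : nu `]-oo, 0[%classic = 0%E ->
    `|\int[nu]_t f t - \int[nu]_t cutln f del (phi t)| <=
    M * (1 - \int[nu]_t cut del (phi t)).
  move=> nu0; rewrite (Rintegral_nonneg nu0 mf).
  have -> : M * (1 - \int[nu]_t cut del (phi t)) = \int[nu]_t (M * (1 - cut del (phi t))).
    rewrite RintegralZl//; last first.
      apply: (@bounded_integrable _ _ _ _ _ (1 + 1)); first exact: measurable_funB.
      by move=> t; rewrite (le_trans (ler_normB _ _))// lerD// normr1.
    rewrite RintegralB//; last 2 first.
    - exact: finite_measure_integrable_cst.
    - exact: (@bounded_integrable _ _ _ _ _ 1).
    by rewrite Rintegral_cst_prob.
  apply: (@ler_norm_RintegralB _ _ _ nu _ _ _ (M * (1 + 1))) => //.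
  - by apply: (measurableT_comp mf); exact: measurable_maxr.
  - exact: mcut.
  - by apply: measurable_funM => //; exact: measurable_funB.
  - by move=> t; rewrite (le_trans (fM _))// ler_peMr ?(ltW Mgt)// lerDr.
  - by move=> t; rewrite (le_trans (cutM f del M t del0 fM))// ler_peMr ?(ltW Mgt)// lerDr.
  - move=> t; rewrite normrM (ger0_norm (ltW Mgt)) ler_pM2l//.
    by rewrite (le_trans (ler_normB _ _))// lerD// normr1.
  move=> t; have {1}-> : Num.max t 0 = - ln (phi t) by rewrite /phi expRK opprK.
  have /andP[c0 c1] := cut01 (phi t) del0.
  rewrite /cutln -{1}[f _]mulr1 -mulrBr normrM [`|1 - _|]ger0_norm ?subr_ge0//.
  by rewrite ler_wpM2r ?subr_ge0.
have cst1M (x : R) : `|(cst 1 : R -> R) x| <= 1 by rewrite normr1.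
have c1 : continuous (cst 1 : R -> R) by move=> x; exact: cvg_cst.
(* The constant 1 as test function transfers the tail bound from [mu] to [mu_ n]. *)
have /cvgrPdist_le/(_ _ e'0) H1 := Hcut _ _ _ del0 c1 cst1M.
have e40 : 0 < e / 4 by rewrite divr_gt0.
have /cvgrPdist_le/(_ _ e40) H2 := Hcut _ _ _ del0 cf fM.
near=> n.
have h1 : `|\int[mu]_t cut del (phi t) - \int[mu_ n]_t cut del (phi t)| <= e'.
  by rewrite -!cut1E; near: n.
have h2 : `|\int[mu]_t cutln f del (phi t) - \int[mu_ n]_t cutln f del (phi t)| <= e / 4.
  by near: n.
have h3 := close mu mu0.
have h4 := close (mu_ n) (mun0 n).
have Me : M * e' = e / 4 by rewrite /e'; field; rewrite gt_eqF.
have h3' : M * (1 - \int[mu]_t cut del (phi t)) <= e / 4.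
  by rewrite -Me ler_pM2l// lerBlDl -lerBlDr.
have h4' : M * (1 - \int[mu_ n]_t cut del (phi t)) <= e / 4 + e / 4.
  rewrite -{1}Me -{1}Me -mulrDr ler_pM2l//.
  move: h1; rewrite ler_distlC => /andP[h1 _]; lra.
rewrite -(subrKA (\int[mu]_t cutln f del (phi t))) (le_trans (ler_normD _ _))//.
rewrite -[X in _ + `|X|](subrKA (\int[mu_ n]_t cutln f del (phi t))).
have := ler_normD (\int[mu]_t cutln f del (phi t) - \int[mu_ n]_t cutln f del (phi t))
   (\int[mu_ n]_t cutln f del (phi t) - \int[mu_ n]_t f t).
rewrite [in X in _ <= _ + X -> _]distrC.
lra.
Unshelve. all: by end_near. Qed.

End laplace_continuity.

(** * Uniqueness of a law given its Laplace transform *)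

Section laplace_unique.
Context {R : realType}.

Lemma eq_prob_of_weak (mu1 mu2 : probability R R) :
    (forall f : R -> R, continuous f -> (exists M : R, forall x, `|f x| <= M) ->
      \int[mu1]_x f x = \int[mu2]_x f x) ->
  forall A, measurable A -> mu1 A = mu2 A.
Proof.
move=> H A mA.
(* Continuous ramps that tend pointwise to the indicator of the open ray above [x]; such rays are
   stable under intersection and generate the Borel sets. *)
pose ramp (x : R) (k : nat) (t : R) := Num.min 1 (k.+1%:R * Num.max (t - x) 0).
have ramp01 x k t : 0 <= ramp x k t <= 1.
  by rewrite /ramp le_min ge_min lexx ler01 mulr_ge0 ?le_max ?lexx ?orbT.
have cramp x k : continuous (ramp x k).
  move=> t.
  apply: (@continuous_min _ _ (cst 1 : R -> R^o) (fun t : R => k.+1%:R * Num.max (t - x) 0 : R^o) t).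
    exact: cvg_cst.
  apply: cvgM; first exact: cvg_cst.
  apply: (@continuous_max _ _ (fun t : R => t - x : R^o) (cst 0 : R -> R^o) t); last exact: cvg_cst.
  by apply: cvgB; [exact: cvg_id|exact: cvg_cst].
have rampM x k t : `|ramp x k t| <= 1.
  by have /andP[r0 r1] := ramp01 x k t; rewrite ger0_norm.
have mramp x k := continuous_measurable_fun (cramp x k).
have lim_ramp (mu : probability R R) x :
    (\int[mu]_t (ramp x k t)%:E)%E @[k --> \oo] --> mu `]x, +oo[%classic.
  have -> : mu `]x, +oo[%classic = (\int[mu]_t (\1_(`]x, +oo[%classic) t)%:E)%E.
    by rewrite integral_indic// setIT.
  have [|||||_ _ H'] := @dominated_convergence _ _ _ mu setT measurableT
      (fun k t => (ramp x k t)%:E) (fun t => (\1_(`]x, +oo[%classic) t)%:E) (cst 1%E).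
  - by move=> k; exact/measurable_EFinP.
  - exact/measurable_EFinP/measurable_indic.
  - apply: aeW => t _; apply: cvg_near_cst; rewrite indicE.
    have [xt|tx] := ltP x t; last first.
      rewrite memNset/=; last by rewrite in_itv/= andbT ltNge tx.
      by exists 0%N => // k _; rewrite /ramp max_r ?subr_le0// mulr0 min_r.
    rewrite mem_set/=; last by rewrite in_itv/= andbT.
    have tx0 : 0 < t - x by rewrite subr_gt0.
    exists (Num.truncn (t - x)^-1) => // k /= Hk.
    rewrite /ramp max_l ?ltW// min_l// -ler_pdivrMr// mul1r ltW//.
    by rewrite (lt_le_trans (truncnS_gt _))// ler_nat ltnS.
  - exact: finite_measure_integrable_cst.
  - by apply: aeW => t k _ /=; rewrite lee_fin.
  exact: H'.
have Iramp x k : (\int[mu1]_t (ramp x k t)%:E = \int[mu2]_t (ramp x k t)%:E)%E.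
  have I1 := bounded_integrable mu1 (mramp x k) (rampM x k).
  have I2 := bounded_integrable mu2 (mramp x k) (rampM x k).
  rewrite -(fineK (integrable_fin_num measurableT I1)).
  rewrite -(fineK (integrable_fin_num measurableT I2)).
  by congr EFin; apply: H => //; exists 1 => t.
have Eray x : mu1 `]x, +oo[%classic = mu2 `]x, +oo[%classic.
  have H1 := lim_ramp mu1 x.
  have E : (fun k => \int[mu1]_t (ramp x k t)%:E)%E =
           (fun k => \int[mu2]_t (ramp x k t)%:E)%E.
    by apply/funext => k; exact: Iramp.
  rewrite E in H1; exact: (cvg_unique _ H1 (lim_ramp mu2 x)).
pose G := [set B : set R | exists x, B = `]x, +oo[%classic].
have GM : G `<=` @measurable _ R by move=> _ [x ->].
apply: (@g_sigma_algebra_measure_unique _ _ _ G GM (fun n => `]- n%:R, +oo[%classic)).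
- by move=> n; exists (- n%:R).
- apply/seteqP; split => // x _; exists (Num.truncn `|x|).+1 => //=.
  rewrite in_itv/= andbT ltrNl (le_lt_trans _ (truncnS_gt _))//.
  by rewrite -normrN ler_norm.
- move=> _ _ [x ->] [y ->]; exists (Num.max x y).
  apply/seteqP; split => t /=; rewrite !in_itv/= !andbT gt_max.
    by move=> [-> ->].
  by move=> /andP[].
- by move=> _ [x ->]; exact: Eray.
- by move=> n; exact: le_lt_trans (probability_le1 _ _) (ltry _).
- have E : @measurable _ R = <<s G >> := RGenOInfty.measurableE R.
  by rewrite -E.
Qed.

(** The continuity theorem applied to the constant sequence [mu1]. *)
Lemma laplace_unique (mu1 mu2 : probability R R) :
    mu1 `]-oo, 0[%classic = 0%E -> mu2 `]-oo, 0[%classic = 0%E ->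
    (forall i : nat, laplace_transform mu1 i%:R = laplace_transform mu2 i%:R) ->
  forall A, measurable A -> mu1 A = mu2 A.
Proof.
move=> mu10 mu20 H; apply: eq_prob_of_weak => f cf fM.
have := @laplace_weakly_converges _ (fun=> mu1) mu2 mu20 (fun=> mu10).
move=> /(_ _ f cf fM) H'.
have {}H' : (fun _ : nat => \int[mu1]_x f x) @ \oo --> \int[mu2]_x f x.
  by apply: H' => i; rewrite -H; exact: cvg_cst.
exact: (cvg_unique _ (cvg_cst _) H').
Qed.

End laplace_unique.

(** * Independent families with prescribed laws *)

Section product_probability.
Context {d1 d2 : measure_display} {T1 : measurableType d1}
  {T2 : measurableType d2} {R : realType}.
Variables (P1 : probability T1 R) (P2 : probability T2 R).

Let prod := (P1 \x P2)%E.

HB.instance Definition _ := Measure.on prod.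

Let prod_setT : prod setT = 1%E.
Proof.
rewrite -setXTT.
have -> : prod (setT `*` setT) = (P1 setT * P2 setT)%E by exact: product_measure1E.
by rewrite !probability_setT mule1.
Qed.

HB.instance Definition _ := Measure_isProbability.Build _ _ _ prod prod_setT.

Definition product_probability : probability (T1 * T2)%type R := prod.

Lemma ge0_integral_product_probability (f : T1 * T2 -> \bar R) :
  measurable_fun setT f -> (forall z, (0 <= f z)%E) ->
  (\int[product_probability]_z f z = \int[P1]_x \int[P2]_y f (x, y))%E.
Proof. by move=> mf f0; rewrite -(fubini_tonelli1 f mf f0). Qed.

End product_probability.

Section independent_family.
Context {R : realType}.

Lemma prode_fin (n : nat) (F : 'I_n -> R) :
  ((\prod_(i < n) F i)%:E = \prod_(i < n) (F i)%:E)%E.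
Proof.
elim: n F => [|n IH] F; first by rewrite !big_ord0.
by rewrite !big_ord_recr/= EFinM IH.
Qed.

(** Independence in the form of a product of expectations, which Tonelli's theorem propagates from
    [n] to [n.+1]. The variables are indexed by [nat] to keep ordinals of varying bounds out of the
    induction; those beyond [n] are fillers. *)
Lemma exists_product_expectation (m : nat -> probability R R) (n : nat) :
  exists (d : measure_display) (T : measurableType d) (P : probability T R)
    (X : nat -> {RV P >-> R}),
  forall g : nat -> R -> R,
    (forall i, measurable_fun setT (g i)) -> (forall i t, 0 <= g i t) ->
  (\int[P]_w (\prod_(i < n) g i (X i w))%:E = \prod_(i < n) \int[m i]_t (g i t)%:E)%E.
Proof.
elim: n => [|n [d [T [P [X IH]]]]].
  exists _, R, (m 0%N), (fun=> cst 0) => g mg g0.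
  rewrite big_ord0; under eq_integral do rewrite big_ord0.
  by rewrite integral_cst// mul1e; exact: probability_setT.
pose Q := product_probability P (m n).
have mX i : measurable_fun setT (fun z : T * R => if (i < n)%N then X i z.1 else z.2).
  by case: (i < n)%N; [exact: measurableT_comp|exact: measurable_snd].
pose Y i : {RV Q >-> R} := mfun_Sub (mem_set (mX i)).
exists _, (T * R)%type, Q, Y => g mg g0.
have YE z : \prod_(i < n.+1) g i (Y i z) = \prod_(i < n) g i (X i z.1) * g n z.2.
  rewrite big_ord_recr/= ltnn; congr (_ * _).
  by apply: eq_bigr => i _; rewrite /= ltn_ord.
under eq_integral do rewrite YE.
have mP : measurable_fun setT (fun w => \prod_(i < n) g i (X i w)).
  by apply: measurable_prod => i _; apply: (measurableT_comp (mg i)).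
have P0 w : 0 <= \prod_(i < n) g i (X i w) by apply: prodr_ge0.
rewrite ge0_integral_product_probability//; last 2 first.
- apply/measurable_EFinP/measurable_funM.
    exact: (measurableT_comp mP).
  exact: (measurableT_comp (mg n)).
- by move=> z; rewrite lee_fin mulr_ge0.
have mgn : measurable_fun setT (fun t => (g n t)%:E) by exact/measurable_EFinP.
transitivity (\int[P]_w ((\prod_(i < n) g i (X i w))%:E * \int[m n]_t (g n t)%:E))%E.
  apply: eq_integral => w _ /=; under eq_integral do rewrite EFinM.
  by rewrite ge0_integralZl_EFin// => t _; rewrite lee_fin.
rewrite ge0_integralZr//; last 3 first.
- exact/measurable_EFinP.
- by move=> w _; rewrite lee_fin.
- by apply: integral_ge0 => t _; rewrite lee_fin.
by rewrite big_ord_recr/= IH.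
Qed.

(** Indicators as test functions yield both the independence and, with all sets but one equal to
    [setT], the marginal laws. *)
Lemma exists_independent_family (m : nat -> probability R R) (n : nat) :
  exists (d : measure_display) (T : measurableType d) (P : probability T R)
    (X : 'I_n -> {RV P >-> R}),
  [/\ mutually_independent P (fun i => X i),
      forall i, has_law P (X i) (m i) &
      forall g : 'I_n -> R -> R,
        (forall i, measurable_fun setT (g i)) -> (forall i t, 0 <= g i t) ->
        (\int[P]_w (\prod_(i < n) g i (X i w))%:E =
         \prod_(i < n) \int[m i]_t (g i t)%:E)%E].
Proof.
have [d [T [P [X H]]]] := exists_product_expectation m n.
have H' (g : 'I_n -> R -> R) : (forall i, measurable_fun setT (g i)) ->
    (forall i t, 0 <= g i t) ->
    (\int[P]_w (\prod_(i < n) g i (X i w))%:E = \prod_(i < n) \int[m i]_t (g i t)%:E)%E.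
  move=> mg g0.
  pose G (k : nat) := if insub k is Some i then g i else cst 0.
  have GE (i : 'I_n) : G i = g i by rewrite /G valK.
  have := H G; under eq_integral do under eq_bigr do rewrite GE.
  under eq_bigr do rewrite GE.
  by apply => [i|i t]; rewrite /G; case: insub.
have mXA (i : 'I_n) A : measurable A -> measurable (X i @^-1` A).
  by move=> mA; rewrite -[X in measurable X]setTI; exact: measurable_funP.
have prod_indic (A : 'I_n -> set R) w :
    \prod_(i < n) (\1_(A i) (X i w) : R) =
    \1_(\bigcap_(i in [set: 'I_n]) (X i @^-1` A i)) w.
  rewrite indicE; case: (boolP (w \in _)) => [|].
    rewrite inE => h; rewrite big1// => i _.
    by rewrite indicE mem_set//; exact: h.
  rewrite notin_setE => h.
  have [i hi] : exists i, ~ A i (X i w).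
    by apply/existsNP => h'; apply: h => i _; exact: h'.
  by rewrite (bigD1 i)//= indicE memNset// mul0r.
have HA (A : 'I_n -> set R) : (forall i, measurable (A i)) ->
    P (\bigcap_(i in [set: 'I_n]) (X i @^-1` A i)) = (\prod_(i < n) m i (A i))%E.
  move=> mA.
  have := H' (fun i => \1_(A i)) (fun i => measurable_indic (mA i)) _.
  under eq_integral do rewrite prod_indic.
  rewrite integral_indic//; last first.
    apply: fin_bigcap_measurable => // i _; exact: mXA.
  rewrite setIT => ->//.
  by apply: eq_bigr => i _; rewrite integral_indic// setIT.
have lawX (i : 'I_n) : has_law P (X i) (m i).
  split; first exact: measurable_funP.
  move=> A mA.
  have := HA (fun j => if j == i then A else setT).
  have -> : \bigcap_(j in [set: 'I_n]) (X j @^-1` (if j == i then A else setT)) = X i @^-1` A.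
    apply/seteqP; split => [w /(_ i I)|w Aw j _]; rewrite ?eqxx//=.
    by case: eqP => [->|].
  move=> ->; last by move=> j; case: ifP.
  rewrite (bigD1 i)//= eqxx big1 ?mule1// => j /negbTE ->.
  exact: probability_setT.
exists d, T, P, (fun i : 'I_n => X i); split => //.
move=> A mA; rewrite HA//; apply: eq_bigr => i _.
by have [_ ->] := lawX i.
Qed.

(** Serves twice: with gamma laws, to build the approximating convolutions, and with unit weights,
    to build convolution powers for infinite divisibility. *)
Lemma laplace_weighted_sum (m : nat -> probability R R) (n : nat) (k : 'I_n -> R) :
    (forall i, 0 < k i) -> (forall i, m i `]-oo, 0[%classic = 0%E) ->
  exists (d : measure_display) (T : measurableType d) (P : probability T R)
    (X : 'I_n -> {RV P >-> R}) (mu : probability R R),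
  [/\ mutually_independent P (fun i => X i),
      forall i, has_law P (X i) (m i),
      has_law P (fun w => \sum_(i < n) k i * X i w) mu,
      mu `]-oo, 0[%classic = 0%E &
      forall lambda, laplace_transform mu lambda =
        (\prod_(i < n) laplace_transform (m i) (lambda * k i))%E].
Proof.
move=> k0 m0.
have [d [T [P [X [indX lawX prodX]]]]] := exists_independent_family m n.
have mS : measurable_fun setT (fun w => \sum_(i < n) k i * X i w).
  by apply: measurable_sum => i; exact: measurable_funM.
pose S : {RV P >-> R} := mfun_Sub (mem_set mS).
exists d, T, P, X, (distribution P S); split => //.
- change (P (S @^-1` `]-oo, 0[%classic) = 0%E).
  have mC (i : 'I_n) : measurable (X i @^-1` `[0, +oo[).
    by rewrite -[X in measurable X]setTI; exact: measurable_funP.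
  (* On this event of probability 1 every summand is nonnegative, hence so is the sum. *)
  pose C := \bigcap_(i in [set: 'I_n]) (X i @^-1` `[0, +oo[).
  have mCC : measurable C by apply: fin_bigcap_measurable.
  have PC : P C = 1%E.
    rewrite /C indX// big1// => i _.
    have [_ ->//] := lawX i.
    have -> : `[0, +oo[%classic = ~` (`]-oo, 0[%classic) :> set R by rewrite setCitvl.
    by rewrite probability_setC// m0 sube0.
  have PNC : P (~` C) = 0%E by rewrite probability_setC// PC subee.
  apply/eqP; rewrite eq_le measure_ge0 andbT -PNC.
  apply: le_measure; rewrite ?inE.
  - by rewrite -[X in measurable X]setTI; exact: measurable_funP.
  - exact: measurableC.
  move=> w /=; rewrite in_itv/= => S0 Cw; move: S0; apply/negP; rewrite -leNgt.
  apply: sumr_ge0 => i _; rewrite mulr_ge0 ?(ltW (k0 i))//.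
  by have := Cw i I; rewrite /= in_itv/= andbT.
move=> lambda.
rewrite /laplace_transform ge0_integral_distribution//; last first.
  by apply/measurable_EFinP; apply: measurableT_comp => //; apply: measurableT_comp => //.
have := prodX (fun i t => expR (- (lambda * k i * t))).
under eq_integral.
  move=> w _.
  have -> : \prod_(i < n) expR (- (lambda * k i * X i w)) =
     expR (- (lambda * \sum_(i < n) k i * X i w)).
    rewrite -expR_sum; congr expR; rewrite sumrN mulr_sumr; congr (- _).
    by apply: eq_bigr => i _; rewrite mulrA.
  over.
apply=> [i|i t]; last exact: expR_ge0.
by apply: measurableT_comp => //; apply: measurableT_comp => //.
Qed.

End independent_family.

(** * Integration against a density *)

Section density.
Context {R : realType} {d : measure_display} {T : measurableType d}.
Variables (mu m : {measure set T -> \bar R}) (D : set T) (f : T -> R).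
Hypotheses (mD : measurable D) (mf : measurable_fun D f).
Hypothesis f0 : forall x, D x -> 0 <= f x.
Hypothesis mE : forall A, measurable A ->
  m A = (\int[mu]_(x in A `&` D) (f x)%:E)%E.

Import HBNNSimple.

Let integral_density_nnsfun (h : {nnsfun T >-> R}) :
  (\int[m]_x (h x)%:E = \int[mu]_(x in D) ((h x)%:E * (f x)%:E))%E.
Proof.
have mh y : measurable (h @^-1` [set y]).
  by rewrite -[X in measurable X]setTI; exact: measurable_funP.
have h0 y x : (0 <= (y * \1_(h @^-1` [set y]) x)%:E :> \bar R)%E.
  by rewrite EFinM; exact: nnfun_muleindic_ge0.
have mi y (E : set T) : measurable_fun E (fun x => (y * \1_(h @^-1` [set y]) x)%:E : \bar R).
  by apply/measurable_EFinP/measurable_funTS/measurable_funM.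
under eq_integral do rewrite fimfunE -fsumEFin//.
rewrite ge0_integral_fsum//.
under [RHS]eq_integral.
  move=> x xD; rewrite fimfunE -fsumEFin// ge0_mule_fsuml//.
  over.
rewrite ge0_integral_fsum//=; last 2 first.
  - by move=> y; apply: emeasurable_funM => //; exact/measurable_EFinP.
  - by move=> y x Dx; rewrite mule_ge0// lee_fin f0.
apply: eq_fsbigr => y; rewrite inE/= => -[t _ ty].
have y0 : 0 <= y by rewrite -ty.
under eq_integral do rewrite EFinM.
rewrite ge0_integralZl_EFin//; last exact/measurable_EFinP/measurable_indic.
under [RHS]eq_integral do rewrite EFinM -muleA.
rewrite ge0_integralZl_EFin//; last 2 first.
- by move=> x Dx; rewrite mule_ge0// lee_fin// f0.
- by apply: emeasurable_funM; apply/measurable_EFinP => //; exact/measurable_funTS/measurable_indic.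
congr (_ * _)%E.
rewrite integral_indic// setIT mE// setIC integral_mkcondr.
apply: eq_integral => x _; rewrite patchE indicE.
by case: ifPn => _; rewrite ?mul1e ?mul0e.
Qed.

Lemma ge0_integral_density (g : T -> \bar R) :
  measurable_fun setT g -> (forall x, (0 <= g x)%E) ->
  (\int[m]_x g x = \int[mu]_(x in D) (g x * (f x)%:E))%E.
Proof.
move=> mg g0; pose h := nnsfun_approx measurableT mg.
have hg x : (h n x)%:E @[n --> \oo] --> g x by exact: cvg_nnsfun_approx.
have ndh x : nondecreasing_seq (fun n => (h n x)%:E).
  by move=> a b ab; rewrite lee_fin; exact/lefP/nd_nnsfun_approx.
have mh n (E : set T) : measurable_fun E (EFin \o h n).
  exact/measurable_EFinP/measurable_funTS.
have H1 : (\int[m]_x (h n x)%:E)%E @[n --> \oo] --> (\int[m]_x g x)%E.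
  rewrite (eq_integral (fun x => limn (fun n => (h n x)%:E))); last first.
    by move=> x _; apply/esym/cvg_lim.
  apply: cvg_monotone_convergence => // [n|n x _]; first exact: mh.
  by rewrite lee_fin.
have H2 : (\int[mu]_(x in D) ((h n x)%:E * (f x)%:E))%E @[n --> \oo] -->
    (\int[mu]_(x in D) (g x * (f x)%:E))%E.
  rewrite (eq_integral (fun x => limn (fun n => (h n x)%:E * (f x)%:E)%E)); last first.
    move=> x _; apply/esym/cvg_lim => //.
    by apply: cvgeZr => //; exact: hg.
  apply: cvg_monotone_convergence => // [n|n x Dx|x Dx a b ab].
  - by apply: emeasurable_funM; [exact: mh|exact/measurable_EFinP].
  - by rewrite mule_ge0// lee_fin// f0.
  - by apply: lee_wpmul2r; [rewrite lee_fin f0|exact: ndh].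
have E : (fun n => \int[m]_x (h n x)%:E)%E =
   (fun n => \int[mu]_(x in D) ((h n x)%:E * (f x)%:E))%E.
  by apply/funext => n; exact: integral_density_nnsfun.
rewrite E in H1.
exact: (cvg_unique _ H1 H2).
Qed.

End density.

Section density_R.
Context {R : realType}.

(* [lebesgue_measure] lives on the measurable structure [measurableTypeR R],
   which carries the same sets as the canonical one on [R] under another
   display: the identity transports [m] to it. *)
Lemma ge0_integral_lebesgue_density (m : {measure set R -> \bar R}) (D : set R)
    (f : R -> R) (g : R -> \bar R) :
    measurable D -> measurable_fun D f -> (forall x, D x -> 0 <= f x) ->
    (forall A, measurable A ->
      m A = (\int[lebesgue_measure]_(x in A `&` D) (f x)%:E)%E) ->
    measurable_fun setT g -> (forall x, (0 <= g x)%E) ->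
  (\int[m]_x g x = \int[lebesgue_measure]_(x in D) (g x * (f x)%:E))%E.
Proof.
move=> mD mf f0 mE mg g0.
have mi : measurable_fun setT (fun x : R => x : measurableTypeR R) by [].
have := ge0_integral_pushforward mi m (D := setT) (f := g) measurableT mg (fun y _ => g0 y).
rewrite preimage_setT => <-.
exact: ge0_integral_density.
Qed.

(** Completing the square: the weight [expR (theta * x)] turns the centred normal density into the
    one of mean [theta * s ^+ 2], up to the constant on the right. *)
Lemma has_law_normal_mgf {d : measure_display} {T : measurableType d}
    (P : probability T R) (X : {RV P >-> R}) (s theta : R) : s != 0 ->
  has_law P X (normal_prob 0 s) ->
  (\int[P]_w (expR (theta * X w))%:E = (expR (theta ^+ 2 * s ^+ 2 / 2))%:E)%E.
Proof.
move=> s0 [_ lX].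
have mf : measurable_fun setT (fun x : R => (expR (theta * x))%:E).
  by apply/measurable_EFinP/measurableT_comp => //; exact: mulrl_measurable.
have f0 (x : R) : (0 <= (expR (theta * x))%:E)%E by rewrite lee_fin expR_ge0.
rewrite -(ge0_integral_distribution X mf f0).
rewrite (@ge0_integral_lebesgue_density _ setT (normal_pdf 0 s))//; last 3 first.
- exact: measurable_normal_pdf.
- by move=> x _; exact: normal_pdf_ge0.
- by move=> A mA; rewrite setIT; exact: lX.
transitivity (\int[lebesgue_measure]_x
   ((expR (theta ^+ 2 * s ^+ 2 / 2))%:E * (normal_pdf (theta * s ^+ 2) s x)%:E))%E.
  apply: eq_integral => x _; rewrite -!EFinM; congr EFin.
  rewrite !normal_pdfE// /normal_fun mulrCA [RHS]mulrCA; congr (_ * _).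
  rewrite -!expRD; congr expR.
  by field.
rewrite ge0_integralZl_EFin//; last 2 first.
- by move=> x _; rewrite lee_fin normal_pdf_ge0.
- by apply/measurable_EFinP; exact: measurable_normal_pdf.
by rewrite integral_normal_pdf mule1.
Qed.

End density_R.

(** * First passage of Brownian motion with drift *)

Section independence.
Context {R : realType} {d : measure_display} {T : measurableType d}.
Variable P : probability T R.

(** The factorization on rectangles identifies the joint law with the product of the marginals, to
    which Tonelli's theorem applies. *)
Lemma ge0_integral_indepM (X Y : {RV P >-> R}) (f g : R -> R) :
    (forall A B, measurable A -> measurable B ->
      P (X @^-1` A `&` Y @^-1` B) = (P (X @^-1` A) * P (Y @^-1` B))%E) ->
    measurable_fun setT f -> measurable_fun setT g ->
    (forall x, 0 <= f x) -> (forall x, 0 <= g x) ->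
  (\int[P]_w (f (X w) * g (Y w))%:E =
   \int[P]_w (f (X w))%:E * \int[P]_w (g (Y w))%:E)%E.
Proof.
move=> ind mf mg f0 g0.
have mXY : measurable_fun setT (fun w => (X w, Y w)).
  exact: measurable_fun_pair.
pose XY : {RV P >-> (R * R)%type} := mfun_Sub (mem_set mXY).
pose F (z : R * R) := ((f z.1 * g z.2)%:E : \bar R).
have mF : measurable_fun setT F.
  apply/measurable_EFinP/measurable_funM.
    exact: (measurableT_comp mf measurable_fst).
  exact: (measurableT_comp mg measurable_snd).
have F0 z : (0 <= F z)%E by rewrite lee_fin mulr_ge0.
transitivity (\int[distribution P XY]_z F z)%E.
  by rewrite ge0_integral_distribution.
transitivity (\int[distribution P X \x distribution P Y]_z F z)%E.
  apply: eq_measure_integral => /= A mA _; apply/esym.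
  exact: product_measure_unique.
rewrite fubini_tonelli1//=.
have mEf : measurable_fun setT (EFin \o f) by exact/measurable_EFinP.
have mEg : measurable_fun setT (EFin \o g) by exact/measurable_EFinP.
have Ef0 x : (0 <= (EFin \o f) x)%E by rewrite lee_fin.
have Eg0 x : (0 <= (EFin \o g) x)%E by rewrite lee_fin.
have <- := ge0_integral_distribution X mEf Ef0.
have <- := ge0_integral_distribution Y mEg Eg0.
have I0 : (0 <= \int[distribution P Y]_y (EFin \o g) y)%E by exact: integral_ge0.
rewrite -(ge0_integralZr (distribution P X) measurableT mEf (fun x _ => Ef0 x) I0).
apply: eq_integral => x _; rewrite /fubini_F /F/=.
under eq_integral do rewrite EFinM.
by rewrite ge0_integralZl_EFin// => y _; rewrite lee_fin.
Qed.

(** The pi-system generating the sigma-algebra of the first [k] increments, [xi k] excluded. *)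
Definition past_cylinders (xi : nat -> T -> R) (k : nat) : set (set T) :=
  [set C | exists2 A : nat -> set R, (forall i, measurable (A i)) &
     C = \bigcap_(i in `I_k) (xi i @^-1` A i)].

Lemma bigcap_ordE (n : nat) (F : nat -> set T) :
  \bigcap_(i in [set: 'I_n]) F i = \bigcap_(i in `I_n) F i.
Proof.
apply/seteqP; split => [w h i /= ilt|w h i _]; first exact: (h (Ordinal ilt) I).
exact: h (ltn_ord i).
Qed.

(** As functions of [C] both sides are finite measures, a restriction and a multiple of [P]; they
    agree on the pi-system of cylinders, hence on the sigma-algebra it generates. *)
Lemma past_indep (xi : nat -> {RV P >-> R}) (k : nat) (C : set T) (A : set R) :
    (forall n, mutually_independent P (fun i : 'I_n => xi i)) ->
    measurable A -> <<s past_cylinders xi k >> C ->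
  P (C `&` xi k @^-1` A) = (P C * P (xi k @^-1` A))%E.
Proof.
move=> ind mA GC.
have mE : measurable (xi k @^-1` A).
  by rewrite -[X in measurable X]setTI; exact: measurable_funP.
set E := xi k @^-1` A in mE *.
have fE : P E \is a fin_num by rewrite fin_num_measure.
pose c := NngNum (fine_ge0 (measure_ge0 P E)).
have cE (D : set T) : mscale c P D = (P D * P E)%E.
  by rewrite muleC -[in RHS](fineK fE).
have GM : past_cylinders xi k `<=` measurable.
  move=> _ [B mB ->]; apply: bigcap_measurableType => i _.
  by rewrite -[X in measurable X]setTI; exact: measurable_funP.
have GT : past_cylinders xi k setT.
  exists (fun=> setT) => //; apply/esym/seteqP; split => // w _ i _.
have : mrestr P mE C = mscale c P C.
  apply: (@g_sigma_algebra_measure_unique _ _ _ _ GM (fun=> setT)) => //.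
  - by apply/seteqP; split => // w _; exists 0%N.
  - move=> _ _ [B1 mB1 ->] [B2 mB2 ->].
    exists (fun i => B1 i `&` B2 i); first by move=> i; exact: measurableI.
    by rewrite -bigcapI; apply: eq_bigcapr => i _.
  - move=> _ [B mB ->]; rewrite [RHS]cE; change (P (\bigcap_(i in `I_k) xi i @^-1` B i `&` E) = P (\bigcap_(i in `I_k) xi i @^-1` B i) * P E)%E.
    have H n (D : nat -> set R) : (forall i, measurable (D i)) ->
        P (\bigcap_(i in `I_n) (xi i @^-1` D i)) =
        (\prod_(i < n) P (xi i @^-1` D i))%E.
      move=> mD; rewrite -(bigcap_ordE _ (fun i => xi i @^-1` D i)).
      exact: (ind n (fun i => D i)).
    rewrite H//.
    (* The cylinder and the condition on [xi k] together form a cylinder over [k.+1] increments. *)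
    pose D i := if (i < k)%N then B i else A.
    have -> : \bigcap_(i in `I_k) xi i @^-1` B i `&` E =
              \bigcap_(i in `I_k.+1) xi i @^-1` D i.
      apply/seteqP; split => [w [h1 h2] i /=|w h].
        rewrite ltnS /D => ik; case: ifPn => ik'; first exact: h1.
        by have -> : i = k by apply/eqP; rewrite eqn_leq ik leqNgt.
      split=> [i /= ik|]; last first.
        by have := h k (ltnSn k); rewrite /D ltnn.
      have := h i (ltnW ik); by rewrite /D ik.
    rewrite H; last by move=> i; rewrite /D; case: ifP.
    rewrite big_ord_recr/= /D ltnn; congr (_ * _)%E.
    by apply: eq_bigr => i _; rewrite ltn_ord.
  - move=> _; change (P (setT `&` E) < +oo)%E; rewrite setTI; exact: le_lt_trans (probability_le1 P mE) (ltry _).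
by rewrite cE.
Qed.

End independence.

(** * Gaussian random walk with drift, stopped at its first step above a level *)

Section stopped_walk.
Context {R : realType} {d : measure_display} {T : measurableType d}.
Variables (P : probability T R) (xi : nat -> {RV P >-> R}) (a h theta y : R).
Hypotheses (h0 : 0 < h) (theta0 : 0 <= theta) (y0 : 0 <= y).
Hypothesis ind : forall n, mutually_independent P (fun i : 'I_n => xi i).
Hypothesis law : forall k, has_law P (xi k) (normal_prob 0 (Num.sqrt h)).

Let lambda := theta * a + theta ^+ 2 / 2.

Definition walk (k : nat) (w : T) : R := \sum_(i < k) xi i w + a * h * k%:R.

Definition exp_mart (k : nat) (w : T) : R :=
  expR (theta * walk k w - lambda * h * k%:R).

(** The indicator that no step from 0 to [k] exceeds [y], written as a real product so that it can
    be multiplied, telescoped and integrated directly. *)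
Definition below (k : nat) (w : T) : R := \prod_(i < k.+1) (walk i w <= y)%R%:R.

(** The index lags by one: the first step above [y] is [k.+1], step 0 being at 0. *)
Definition first_hit (k : nat) (w : T) : R := below k w * (y < walk k.+1 w)%R%:R.

Lemma walkS k w : walk k.+1 w = walk k w + (xi k w + a * h).
Proof. by rewrite /walk big_ord_recr/= -natr1; ring. Qed.

Lemma below0 w : below 0 w = 1.
Proof. by rewrite /below big_ord1 /walk big_ord0 mulr0 addr0 y0. Qed.

Lemma belowS k w : below k.+1 w = below k w * (walk k.+1 w <= y)%R%:R.
Proof. by rewrite /below big_ord_recr. Qed.

Lemma below_bool k w : below k w = 0 \/ (below k w = 1 /\ walk k w <= y).
Proof.
elim: k => [|k IH]; first by right; rewrite below0 /walk big_ord0 mulr0 addr0.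
rewrite belowS; case: IH => [->|[-> _]]; first by left; rewrite mul0r.
by case: (leP (walk k.+1 w) y) => _; [right; rewrite mulr1|left; rewrite mulr0].
Qed.

Lemma below_ge0 k w : 0 <= below k w.
Proof. by case: (below_bool k w) => [->|[-> _]]. Qed.

Lemma first_hitE k w : first_hit k w = below k w - below k.+1 w.
Proof.
by rewrite /first_hit belowS ltNge; case: (walk k.+1 w <= y)%R;
  rewrite ?mulr1 ?mulr0 ?subrr ?subr0.
Qed.

Lemma first_hit_ge0 k w : 0 <= first_hit k w.
Proof. by rewrite mulr_ge0 ?below_ge0. Qed.

Lemma sum_first_hit n w : \sum_(k < n) first_hit k w = 1 - below n w.
Proof.
elim: n => [|n IH]; first by rewrite big_ord0 below0 subrr.
by rewrite big_ord_recr/= IH first_hitE; ring.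
Qed.

Lemma sum_first_hit_le n w : \sum_(k < n) first_hit k w <= 1.
Proof. by rewrite sum_first_hit gerBl below_ge0. Qed.

Notation past k := (g_sigma_algebraType (past_cylinders xi k)).

Lemma past_sub k : past_cylinders xi k `<=` @measurable _ T.
Proof.
move=> _ [B mB ->]; apply: bigcap_measurableType => i _.
by rewrite -[X in measurable X]setTI; exact: measurable_funP.
Qed.

Lemma measurable_past k (f : T -> R) :
  measurable_fun setT (f : past k -> R) -> measurable_fun setT f.
Proof.
move=> mf _ A mA; have := mf measurableT A mA.
rewrite !setTI; apply: smallest_sub; last exact: past_sub.
exact: sigma_algebra_measurable.
Qed.

Lemma measurable_past_xi i k : (i < k)%N ->
  measurable_fun setT (xi i : past k -> R).
Proof.
move=> ik _ A mA; rewrite setTI; apply: sub_sigma_algebra.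
exists (fun j => if j == i then A else setT).
  by move=> j; case: ifP.
apply/seteqP; split => [w Aw j /= jk|w /(_ i ik)/=]; last by rewrite eqxx.
by case: eqP => [->|].
Qed.

Lemma measurable_past_walk i k : (i <= k)%N ->
  measurable_fun setT (walk i : past k -> R).
Proof.
move=> ik; apply: measurable_funD; last exact: measurable_cst.
apply: measurable_sum => j; apply: measurable_past_xi.
exact: leq_trans (ltn_ord j) ik.
Qed.

Lemma measurable_past_below k : measurable_fun setT (below k : past k -> R).
Proof.
apply: measurable_prod => j _.
apply: (@measurableT_comp _ _ _ _ _ _ (fun b : bool => b%:R : R)) => //.
apply: measurable_fun_ler => //.
by apply: measurable_past_walk; rewrite -ltnS.
Qed.

Lemma measurable_past_mart k : measurable_fun setT (exp_mart k : past k -> R).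
Proof.
apply: measurableT_comp => //; apply: measurable_funB => //.
apply: measurable_funM => //; exact: measurable_past_walk.
Qed.

Lemma measurable_below k : measurable_fun setT (below k).
Proof. by apply: (@measurable_past k); exact: measurable_past_below. Qed.

Lemma measurable_mart k : measurable_fun setT (exp_mart k).
Proof. by apply: (@measurable_past k); exact: measurable_past_mart. Qed.

Lemma measurable_first_hit k : measurable_fun setT (first_hit k).
Proof.
rewrite (_ : first_hit k = fun w => below k w - below k.+1 w).
  by apply: measurable_funB; exact: measurable_below.
by apply/funext => w; rewrite first_hitE.
Qed.

Lemma mgf_xi k t :
  (\int[P]_w (expR (t * xi k w))%:E = (expR (t ^+ 2 * h / 2))%:E)%E.
Proof.
rewrite (@has_law_normal_mgf _ _ _ _ _ (Num.sqrt h))//.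
  by rewrite sqr_sqrtr ?ltW.
by rewrite gt_eqF// sqrtr_gt0.
Qed.

(** The martingale property tested on the event [below k], which depends on the first [k] increments
    only; the exponential moment of the independent [xi k] is exactly offset by one step of discount
    at rate [lambda]. *)
Lemma integral_below_mart_next k :
  (\int[P]_w (below k w * exp_mart k.+1 w)%:E =
   \int[P]_w (below k w * exp_mart k w)%:E)%E.
Proof.
have mp : measurable_fun setT ((fun w => below k w * exp_mart k w) : past k -> R).
  by apply: measurable_funM; [exact: measurable_past_below|exact: measurable_past_mart].
pose Y : {RV P >-> R} := mfun_Sub (mem_set (measurable_past mp)).
have Y0 w : 0 <= Y w by rewrite mulr_ge0 ?below_ge0 ?expR_ge0.
pose c := expR (- (theta ^+ 2 * h / 2)).
have c0 : 0 <= c by exact: expR_ge0.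
have mg : measurable_fun setT (fun x : R => expR (theta * x)).
  by apply: measurableT_comp => //; exact: mulrl_measurable.
(* The absolute value changes nothing on the nonnegative [Y], but gives [ge0_integral_indepM] a
   function that is nonnegative on the whole line. *)
have E w : ((below k w * exp_mart k.+1 w)%:E =
    c%:E * (`|Y w| * expR (theta * xi k w))%:E)%E.
  rewrite ger0_norm ?Y0// /Y/= -EFinM; congr EFin.
  rewrite -mulrA mulrCA; congr (_ * _).
  rewrite /c /exp_mart -!expRD; congr expR.
  by rewrite walkS /lambda -natr1; field.
under eq_integral do rewrite E.
rewrite ge0_integralZl_EFin//; last first.
  apply/measurable_EFinP/measurable_funM.
    exact: measurableT_comp.
  exact: (measurableT_comp mg).
rewrite (@ge0_integral_indepM _ _ _ P Y (xi k) (fun x => `|x|) (fun x => expR (theta * x)))//; last first.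
  move=> A B mA mB; apply: past_indep => //.
  by have := mp measurableT A mA; rewrite setTI.
rewrite mgf_xi muleCA -EFinM -expRD addNr expR0 mule1.
by apply: eq_integral => w _; rewrite ger0_norm.
Qed.

Lemma below_split k w :
  below k w * exp_mart k.+1 w =
  below k.+1 w * exp_mart k.+1 w + first_hit k w * exp_mart k.+1 w.
Proof. by rewrite first_hitE; ring. Qed.

(** The martingale stopped at the first hit or at step [n], its expectation split accordingly; each
    induction step splits the paths still below into those that stay below and those that hit. *)
Lemma optional_stopping n :
  (\int[P]_w (below n w * exp_mart n w)%:E +
   \sum_(k < n) \int[P]_w (first_hit k w * exp_mart k.+1 w)%:E = 1)%E.
Proof.
elim: n => [|n IH].
  rewrite big_ord0 adde0.
  under eq_integral do rewrite below0 mul1r /exp_mart /walk big_ord0 mulr0 addr0 !mulr0 subr0 expR0.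
  by rewrite integral_cst// mul1e; exact: probability_setT.
have mM := measurable_mart n.+1.
have key : (\int[P]_w (below n w * exp_mart n w)%:E =
    \int[P]_w (below n.+1 w * exp_mart n.+1 w)%:E +
    \int[P]_w (first_hit n w * exp_mart n.+1 w)%:E)%E.
  rewrite -integral_below_mart_next.
  under eq_integral do rewrite below_split EFinD.
  rewrite ge0_integralD//.
  - by move=> w _; rewrite lee_fin mulr_ge0 ?below_ge0 ?expR_ge0.
  - by apply/measurable_EFinP/measurable_funM => //; exact: measurable_below.
  - by move=> w _; rewrite lee_fin mulr_ge0 ?first_hit_ge0 ?expR_ge0.
  - by apply/measurable_EFinP/measurable_funM => //; exact: measurable_first_hit.
rewrite big_ord_recr/= -IH key.
set I1 := integral _ _ _; set I2 := integral _ _ _; set S := (\sum_(i < n) _)%R.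
by rewrite -addeA (addeC I2).
Qed.

Hypothesis a0 : 0 <= a.

Lemma lambda_ge0 : 0 <= lambda.
Proof. by rewrite addr_ge0 ?mulr_ge0 ?sqr_ge0// invr_ge0. Qed.

Definition discount (k : nat) : R := expR (- (lambda * (h * k%:R))).

(** At most one summand is nonzero: this is [exp (- lambda tau)], with [tau] the sampled hitting
    time, set to 0 if there is no hit within [n] steps. *)
Definition discounted_hit (n : nat) (w : T) : R :=
  \sum_(k < n) first_hit k w * discount k.+1.

Lemma discount_le j k : (j <= k)%N -> discount k <= discount j.
Proof.
move=> jk; rewrite ler_expR lerN2 ler_wpM2l ?lambda_ge0// ler_wpM2l ?(ltW h0)//.
by rewrite ler_nat.
Qed.

Lemma discounted_hit_ge0 n w : 0 <= discounted_hit n w.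
Proof. by apply: sumr_ge0 => k _; rewrite mulr_ge0 ?first_hit_ge0 ?expR_ge0. Qed.

Lemma measurable_discounted_hit n : measurable_fun setT (discounted_hit n).
Proof.
apply: measurable_sum => k; apply: measurable_funM => //.
exact: measurable_first_hit.
Qed.

Lemma discounted_hit_le n w c : 0 <= c ->
    (forall k, (k < n)%N -> y < walk k.+1 w -> discount k.+1 <= c) ->
  discounted_hit n w <= c.
Proof.
move=> c0 H; apply: (@le_trans _ _ (\sum_(k < n) first_hit k w * c)).
  apply: ler_sum => k _; rewrite /first_hit.
  case: ltP => [yw|_]; last by rewrite mulr0 !mul0r.
  by rewrite ler_wpM2l ?mulr_ge0 ?below_ge0// H.
by rewrite -mulr_suml ler_piMl// sum_first_hit_le.
Qed.

(** A walk above [y] at step [k.+1] has its first hit no later, and the discount decreases with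
    time. *)
Lemma discounted_hit_ge n w k : (k < n)%N -> y < walk k.+1 w ->
  discount k.+1 <= discounted_hit n w.
Proof.
elim: n => [//|n IH]; rewrite ltnS leq_eqVlt => /orP[/eqP <-|kn] yw; last first.
  rewrite /discounted_hit big_ord_recr/= (le_trans (IH kn yw))// lerDl.
  by rewrite mulr_ge0 ?first_hit_ge0 ?expR_ge0.
have -> : discount k.+1 = \sum_(j < k.+1) first_hit j w * discount k.+1.
  by rewrite -mulr_suml sum_first_hit belowS leNgt yw mulr0 subr0 mul1r.
apply: ler_sum => j _; rewrite ler_wpM2l ?first_hit_ge0//.
exact: discount_le.
Qed.

Let hd_ge0 k j w : 0 <= first_hit k w * discount j.
Proof. by rewrite mulr_ge0 ?first_hit_ge0 ?expR_ge0. Qed.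

Lemma integral_discounted_hit n :
  (\int[P]_w (discounted_hit n w)%:E =
   \sum_(k < n) \int[P]_w (first_hit k w * discount k.+1)%:E)%E.
Proof.
under eq_integral do rewrite -sumEFin.
rewrite ge0_integral_sum// => k.
  by apply/measurable_EFinP/measurable_funM => //; exact: measurable_first_hit.
by move=> w _; rewrite lee_fin mulr_ge0 ?first_hit_ge0 ?expR_ge0.
Qed.

(** At the hit the walk exceeds [y], so the martingale is at least [expR (theta * y)] times the
    discount; the paths still below contribute a nonnegative term to [optional_stopping]. *)
Lemma discounted_hit_upper n :
  (\int[P]_w (discounted_hit n w)%:E <= (expR (- (theta * y)))%:E)%E.
Proof.
have mH n' := measurable_discounted_hit n'.
suff H : ((expR (theta * y))%:E * \int[P]_w (discounted_hit n w)%:E <= 1)%E.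
  rewrite expRN -[leRHS]mule1; set e := expR _ in H *.
  have e0 : 0 < e by exact: expR_gt0.
  rewrite -[leLHS]mul1e -[X in (X%:E * _)%E](mulVf (lt0r_neq0 e0)) EFinM -muleA.
  by apply: lee_wpmul2l => //; rewrite lee_fin invr_ge0 ltW.
rewrite integral_discounted_hit ge0_sume_distrr; last first.
  move=> k _; apply: integral_ge0 => w _.
  by rewrite lee_fin mulr_ge0 ?first_hit_ge0 ?expR_ge0.
rewrite -(optional_stopping n) -[leLHS]add0e; apply: leeD.
  by apply: integral_ge0 => w _; rewrite lee_fin mulr_ge0 ?below_ge0 ?expR_ge0.
apply: lee_sum => k _.
rewrite -ge0_integralZl_EFin ?expR_ge0//; last 2 first.
- by move=> w _; rewrite lee_fin mulr_ge0 ?first_hit_ge0 ?expR_ge0.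
- by apply/measurable_EFinP/measurable_funM => //; exact: measurable_first_hit.
apply: ge0_le_integral => //.
- by move=> w _; rewrite -EFinM lee_fin mulr_ge0 ?expR_ge0 ?hd_ge0.
- under eq_fun do rewrite -EFinM; apply/measurable_EFinP/measurable_funM => //.
  by apply: measurable_funM => //; exact: measurable_first_hit.
- apply/measurable_EFinP/measurable_funM => //; first exact: measurable_first_hit.
  exact: measurable_mart.
- move=> w _; rewrite -EFinM lee_fin mulrCA /first_hit.
  case: ltP => [yw|_]; last by rewrite mulr0 !mul0r.
  rewrite ler_wpM2l ?mulr_ge0 ?below_ge0// /discount /exp_mart -expRD ler_expR.
  by rewrite mulrA lerB// ler_wpM2l// ltW.
Qed.

(* An overshoot by more than [eps] forces an increment larger than [eps],
   which the Chernoff weight [expR (p * (increment - eps))] makes rare. *)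
Lemma first_hit_mart_le k (eps p : R) w : 0 < eps -> 0 <= p ->
  first_hit k w * exp_mart k.+1 w <=
  expR (theta * (y + eps)) * (first_hit k w * discount k.+1) +
  expR (theta * y - p * eps + (theta + p) * (a * h)) * expR ((theta + p) * xi k w).
Proof.
move=> e0 p0; rewrite /first_hit.
case: ltP => [yw|_]; last first.
  by rewrite !(mulr0, mul0r) add0r mulr_ge0 ?expR_ge0.
case: (below_bool k w) => [->|[-> wy]].
  by rewrite !(mulr0, mul0r) add0r mulr_ge0 ?expR_ge0.
rewrite !mul1r; have [wye|wye] := leP (walk k.+1 w) (y + eps).
  rewrite -[leLHS]addr0 lerD ?mulr_ge0 ?expR_ge0//.
  rewrite /discount /exp_mart -expRD ler_expR mulrA lerB//.
  by rewrite ler_wpM2l.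
rewrite -[leLHS]add0r lerD ?mulr_ge0 ?expR_ge0//.
rewrite /exp_mart -expRD ler_expR.
have l0 : 0 <= lambda * h * k.+1%:R by rewrite !mulr_ge0 ?lambda_ge0// ltW.
move: wye; rewrite walkS => wye.
have H1 : 0 <= theta * (y - walk k w) by rewrite mulr_ge0// subr_ge0.
have H2 : 0 <= p * (xi k w + a * h - eps) by rewrite mulr_ge0//; lra.
rewrite -subr_ge0.
have -> : theta * y - p * eps + (theta + p) * (a * h) + (theta + p) * xi k w -
   (theta * (walk k w + (xi k w + a * h)) - lambda * h * k.+1%:R) =
   theta * (y - walk k w) + p * (xi k w + a * h - eps) + lambda * h * k.+1%:R by ring.
by rewrite !addr_ge0.
Qed.

(** The first term collects the Chernoff bounds of overshoots at each of the [n] steps, the Gaussian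
    moment included; the second bounds the martingale on the paths that stay below [y] up to time
    [h * n]. *)
Definition overshoot_error (n : nat) (eps p : R) : R :=
  n%:R * expR (theta * y - p * eps + (theta + p) * (a * h) + (theta + p) ^+ 2 * h / 2)
  + expR (theta * y - lambda * (h * n%:R)).

Lemma discounted_hit_lower n (eps p : R) : 0 < eps -> 0 <= p ->
  (1 <= (expR (theta * (y + eps)))%:E * \int[P]_w (discounted_hit n w)%:E +
        (overshoot_error n eps p)%:E)%E.
Proof.
move=> e0 p0; rewrite -[leLHS](optional_stopping n) /overshoot_error EFinD addeA [leRHS]addeC.
apply: leeD.
  have -> : ((expR (theta * y - lambda * (h * n%:R)))%:E =
      \int[P]_w (cst (expR (theta * y - lambda * (h * n%:R)))%:E) w)%E.
    by rewrite integral_cst//= probability_setT mule1.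
  apply: ge0_le_integral => //.
  - by move=> w _; rewrite lee_fin mulr_ge0 ?below_ge0 ?expR_ge0.
  - apply/measurable_EFinP/measurable_funM; first exact: measurable_below.
    exact: measurable_mart.
  move=> w _; rewrite lee_fin/=; case: (below_bool n w) => [->|[-> wy]].
    by rewrite mul0r expR_ge0.
  by rewrite mul1r ler_expR mulrA lerB// ler_wpM2l.
rewrite integral_discounted_hit ge0_sume_distrr; last first.
  move=> k _; apply: integral_ge0 => w _.
  by rewrite lee_fin mulr_ge0 ?first_hit_ge0 ?expR_ge0.
set c := expR (theta * y - p * eps + _ + _).
have -> : ((n%:R * c)%:E = \sum_(k < n) c%:E)%E.
  by rewrite sumEFin sumr_const card_ord mulr_natl.
rewrite -big_split/=; apply: lee_sum => k _.
pose c1 := expR (theta * y - p * eps + (theta + p) * (a * h)).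
have mfh := measurable_first_hit k.
have mx : measurable_fun setT (fun w => expR ((theta + p) * xi k w)).
  by apply: measurableT_comp => //; apply: measurable_funM.
have -> : (c%:E = \int[P]_w (c1 * expR ((theta + p) * xi k w))%:E)%E.
  under eq_integral do rewrite EFinM.
  rewrite ge0_integralZl_EFin ?expR_ge0//; last exact/measurable_EFinP.
  by rewrite mgf_xi -EFinM /c1 -expRD.
rewrite -ge0_integralZl_EFin ?expR_ge0//; last 2 first.
- by move=> w _; rewrite lee_fin mulr_ge0 ?first_hit_ge0 ?expR_ge0.
- by apply/measurable_EFinP/measurable_funM.
under [X in (_ <= X + _)%E]eq_integral do rewrite -EFinM.
rewrite -ge0_integralD//; last 4 first.
- by move=> w _; rewrite lee_fin mulr_ge0 ?expR_ge0 ?hd_ge0.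
- by apply/measurable_EFinP/measurable_funM => //; exact: measurable_funM.
- by move=> w _; rewrite lee_fin mulr_ge0 ?expR_ge0.
- by apply/measurable_EFinP/measurable_funM.
apply: ge0_le_integral => //.
- by move=> w _; rewrite lee_fin mulr_ge0 ?first_hit_ge0 ?expR_ge0.
- by apply/measurable_EFinP/measurable_funM => //; exact: measurable_mart.
- under eq_fun do rewrite -EFinD; apply/measurable_EFinP/measurable_funD.
    by apply: measurable_funM => //; exact: measurable_funM.
  exact: measurable_funM.
- by move=> w _; rewrite -EFinD lee_fin first_hit_mart_le.
Qed.

End stopped_walk.

(** * The passage time along continuous paths: attainment and measurability *)

Section first_passage.
Context {R : realType} {d : measure_display} {T : measurableType d}.
Variables (P : probability T R) (B : R -> {RV P >-> R}) (a : R).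
Hypotheses (hB : standard_brownian_motion B) (a0 : 0 < a).

Definition drifted (t : R) (w : T) : R := B t w + a * t.

Lemma drifted0 w : drifted 0 w = 0.
Proof. by case: hB => B0 _ _ _; rewrite /drifted B0 mulr0 addr0. Qed.

Lemma drifted_continuous w : {within `[0, +oo[, continuous (drifted ^~ w)}.
Proof.
case: hB => _ cB _ _ t.
apply: cvgD; first exact: cB.
by apply: cvgM; [exact: cvg_cst|apply: continuous_subspaceT => ?; exact: cvg_id].
Qed.

(** Paths are constrained at nonnegative times only, so continuity at 0 is one-sided and treated
    apart. *)
Lemma drifted_near w (s e : R) : 0 <= s -> 0 < e ->
  exists2 delta : R, 0 < delta &
    forall t : R, 0 <= t -> `|s - t| < delta -> `|drifted s w - drifted t w| < e.
Proof.
move=> s0 e0; have /continuous_within_itvcyP := @drifted_continuous w.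
move=> -[c1 c2]; have [->|sn0] := eqVneq s 0.
  have /cvgrPdist_lt/(_ e e0) := c2.
  move=> [del /= del0 H]; exists del => // t t0 st.
  have [->|tn0] := eqVneq t 0; first by rewrite subrr normr0.
  by apply: H => //=; rewrite lt_neqAle eq_sym tn0.
have sgt : 0 < s by rewrite lt_neqAle eq_sym sn0.
have /cvgrPdist_lt/(_ e e0) : drifted t w @[t --> s] --> drifted s w.
  by apply: c1; rewrite in_itv/= sgt.
by move=> [del /= del0 H]; exists del => // t t0 st; exact: H.
Qed.

Lemma first_passage_ge0 (x : R) w : (0 <= first_passage_time B a x w)%E.
Proof. by apply: le_ereal_inf_tmp => _ [t [t0 _] <-]; rewrite lee_fin. Qed.

(** The path starts at 0, below [x], so the intermediate value theorem yields a time in [0, t] at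
    which it equals [x]. *)
Lemma first_passage_le (x t : R) w : 0 < x -> 0 <= t -> x <= drifted t w ->
  (first_passage_time B a x w <= t%:E)%E.
Proof.
move=> x0 t0 xt.
have cw : {within `[0, t], continuous (drifted ^~ w)}.
  apply: continuous_subspaceW (@drifted_continuous w) => u /=.
  by rewrite !in_itv/= andbT => /andP[].
have [|c] := IVT (v := x) t0 cw.
  by rewrite drifted0 ge_min le_max (ltW x0) xt orbT.
rewrite in_itv/= => /andP[c0 ct] cx.
apply: (@le_trans _ _ c%:E); last by rewrite lee_fin.
by apply: ereal_inf_lbound; exists c.
Qed.

(** By continuity the set of times spent at the level is closed, so it contains its finite
    infimum. *)
Lemma first_passage_attained (x : R) w : (first_passage_time B a x w < +oo)%E ->
  exists s, [/\ 0 <= s, first_passage_time B a x w = s%:E & drifted s w = x].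
Proof.
move=> Ty; have T0 := first_passage_ge0 x w.
have Tfin : first_passage_time B a x w \is a fin_num by rewrite ge0_fin_numE.
exists (fine (first_passage_time B a x w)).
split; [by rewrite fine_ge0|by rewrite fineK|].
set s := fine _; have s0 : 0 <= s by rewrite fine_ge0.
apply/eqP; rewrite -subr_eq0 -normr_eq0 eq_le normr_ge0 andbT.
apply/ler_addgt0Pr => e e0; rewrite add0r.
have [del del0 H] := @drifted_near w _ _ s0 e0.
have [_ [t [t0 tx] <-]] := lb_ereal_inf_adherent del0 Tfin.
rewrite -/(first_passage_time B a x w) -(fineK Tfin) -EFinD lte_fin => ts.
have st : s <= t.
  rewrite -lee_fin /s fineK//; apply: ereal_inf_lbound; by exists t.
rewrite -tx; apply/ltW/H => //.
by rewrite distrC ger0_norm ?subr_ge0// ltrBlDl.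
Qed.

(** Expresses the event by countably many times, for measurability. The margin [m.+1%:R^-1] is there
    because the level may be reached at an irrational time only. *)
Lemma first_passage_leP (x t : R) w : 0 < x -> 0 <= t ->
  (first_passage_time B a x w <= t%:E)%E <->
  forall m : nat, exists q : rat,
    [/\ 0 <= ratr q :> R, ratr q <= t & x - m.+1%:R^-1 < drifted (ratr q) w].
Proof.
move=> x0 t0; split => [Tt m|H].
  have [|s [s0 Ts sx]] := @first_passage_attained (x : R) w.
    exact: le_lt_trans Tt (ltry _).
  have {}st : s <= t by rewrite -lee_fin -Ts.
  have m0 : 0 < m.+1%:R^-1 :> R by rewrite invr_gt0.
  have [del del0 Hd] := @drifted_near w _ _ s0 m0.
  (* A positive passage time leaves room for a rational time strictly before it. *)
  have sgt : 0 < s.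
    rewrite lt_neqAle s0 andbT; apply/negP => /eqP sE.
    by move: x0; rewrite -sx -sE drifted0 ltxx.
  have [|q] := @rat_in_itvoo R (Num.max 0 (s - del)) s.
    by rewrite gt_max sgt ltrBlDr ltrDl.
  rewrite in_itv/= gt_max => /andP[/andP[q0 sq] qs].
  exists q; split; [exact: ltW|exact: le_trans (ltW qs) st|].
  have /Hd : 0 <= ratr q :> R by exact: ltW.
  rewrite ger0_norm ?subr_ge0 ?(ltW qs)// ltrBlDl -ltrBlDr => /(_ sq).
  by rewrite sx => /ltr_distlDr; rewrite ltrBlDr.
have cw : {within `[0, t], continuous (drifted ^~ w)}.
  apply: continuous_subspaceW (@drifted_continuous w) => u /=.
  by rewrite !in_itv/= andbT => /andP[].
(* The maximum over [0, t] exceeds every [x - m.+1%:R^-1], hence is at least [x]. *)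
have [c] := EVT_max t0 cw; rewrite in_itv/= => /andP[c0 ct] cmax.
have xc : x <= drifted c w.
  apply/ler_addgt0Pr => e e0.
  have [m me] : exists m : nat, m.+1%:R^-1 < e.
    have [m _ /(_ m (leqnn m))] := near_infty_natSinv_lt (PosNum e0).
    by move=> ?; exists m.
  have [q [q0 qt xq]] := H m.
  have /cmax qc : ratr q \in `[0, t] by rewrite in_itv/= q0.
  by apply: le_trans (lerD qc (ltW me)); rewrite -lerBlDr ltW.
apply: le_trans (first_passage_le x0 c0 xc) _.
by rewrite lee_fin.
Qed.

Lemma measurable_drifted t : measurable_fun setT (drifted t).
Proof. exact: measurable_funD. Qed.

Lemma measurable_first_passage (x : R) : 0 < x ->
  measurable_fun setT (first_passage_time B a x).
Proof.
move=> x0.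
apply: (measurability _ (ErealGenOInfty.measurableE R)) => _ [_ [t ->] <-].
rewrite setTI; have [t0|t0] := leP 0 t; last first.
  rewrite (_ : _ @^-1` _ = setT); first exact: measurableT.
  apply/seteqP; split => // w _ /=; rewrite in_itv/= andbT.
  by apply: lt_le_trans (first_passage_ge0 x w); rewrite lte_fin.
rewrite (_ : _ @^-1` _ = ~` (\bigcap_(m in [set: nat]) \bigcup_(q in [set q : rat | 0 <= ratr q :> R /\ ratr q <= t])
   [set w | x - m.+1%:R^-1 < drifted (ratr q) w])).
  apply: measurableC; apply: bigcap_measurableType => m _.
  rewrite bigcup_mkcond; apply: bigcupT_measurable_rat => q; case: ifP => // _.
  rewrite (_ : [set w | _] = drifted (ratr q) @^-1` `]x - m.+1%:R^-1, +oo[).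
    rewrite -[X in measurable X]setTI; apply: measurable_drifted => //.
  by apply/seteqP; split => w /=; rewrite in_itv/= andbT.
apply/seteqP; split => w /=; rewrite in_itv/= andbT.
  rewrite ltNge => /negP; apply: contra_not => H.
  apply/first_passage_leP => // m.
  by have [q [q0 qt] xq] := H m I; exists q.
rewrite ltNge => H; apply/negP => /first_passage_leP -/(_ x0 t0) H'.
apply: H => m _; have [q [q0 qt xq]] := H' m.
by exists q.
Qed.

End first_passage.

(** * Laplace transform of the passage time, by refinement of the sampling *)

Section first_passage_laplace.
Context {R : realType} {d : measure_display} {T : measurableType d}.
Variables (P : probability T R) (B : R -> {RV P >-> R}) (a : R).
Hypotheses (hB : standard_brownian_motion B) (a0 : 0 < a).

Notation fpt := (first_passage_time B a).

Definition increment (h : R) (k : nat) : {RV P >-> R} :=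
  B (h * k.+1%:R) - B (h * k%:R).

Lemma incrementE h k w :
  increment h k w = B (h * k.+1%:R) w - B (h * k%:R) w.
Proof. by []. Qed.

Lemma increment_independent h n : 0 <= h ->
  mutually_independent P (fun i : 'I_n => increment h i).
Proof.
case: hB => _ _ _ ind h0.
apply: (ind n (fun k => h * k%:R)); first by rewrite mulr0.
by move=> i; rewrite ler_wpM2l// ler_nat.
Qed.

Lemma increment_law (h : R) k : 0 < h ->
  has_law P (increment h k) (normal_prob 0 (Num.sqrt h)).
Proof.
case: hB => _ _ law _ h0.
(* Meant for the variance; the mesh inside [increment] is rewritten as well and is restored by the
   next equation. *)
have -> : h = h * k.+1%:R - h * k%:R by rewrite -natr1; ring.
have -> : increment (h * k.+1%:R - h * k%:R) k = increment h k.
  by congr increment; rewrite -natr1; ring.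
by apply: law; rewrite ?mulr_ge0 ?(ltW h0)// ltr_pM2l// ltr_nat.
Qed.

Lemma walk_increment h k w : walk (increment h) a h k w = drifted B a (h * k%:R) w.
Proof.
case: hB => B0 _ _ _; elim: k => [|k IH].
  by rewrite /walk big_ord0 /drifted !mulr0 B0.
by rewrite walkS IH /drifted incrementE -natr1 mulrDr mulr1; ring.
Qed.

(** The indicator is essential: [fine] sends [+oo] to 0, which would give discount 1 to the paths
    that never reach [x]. *)
Definition hit_discount (lambda x : R) (w : T) : R :=
  \1_[set w | (fpt x w < +oo)%E] w * expR (- (lambda * fine (fpt x w))).

Lemma hit_discountNy lambda x w : fpt x w = +oo%E -> hit_discount lambda x w = 0.
Proof. by move=> Ty; rewrite /hit_discount indicE memNset ?mul0r//= Ty ltxx. Qed.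

Lemma hit_discountE lambda x w s : fpt x w = s%:E ->
  hit_discount lambda x w = expR (- (lambda * s)).
Proof. by move=> Ts; rewrite /hit_discount indicE mem_set/= Ts ?ltry// mul1r. Qed.

Lemma hit_discount_ge0 lambda x w : 0 <= hit_discount lambda x w.
Proof. by rewrite mulr_ge0 ?expR_ge0. Qed.

Lemma first_passageP (x : R) w : 0 < x -> fpt x w = +oo%E \/
  exists s, [/\ 0 <= s, fpt x w = s%:E & drifted B a s w = x].
Proof.
move=> x0; have [Ty|] := eqVneq (fpt x w) +oo%E; first by left.
by rewrite -ltey => /(first_passage_attained hB) H; right.
Qed.

Lemma measurable_hit_discount (lambda x : R) : 0 < x ->
  measurable_fun setT (hit_discount lambda x).
Proof.
move=> x0; have mT := measurable_first_passage a hB x0.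
apply: measurable_funM.
  apply: measurable_indic; rewrite -[X in measurable X]setTI.
  exact: emeasurable_fun_infty_o.
apply: measurableT_comp => //; apply: measurableT_comp => //.
apply: measurable_funM => //; apply: measurableT_comp => //.
Qed.

(** A path above [x] at a sampling time has already passed [x], so the sampled hit comes later and
    is discounted more. *)
Lemma discounted_hit_le_hit (h theta x : R) n w : 0 < h -> 0 <= theta -> 0 < x ->
  discounted_hit (increment h) a h theta x n w <=
  hit_discount (theta * a + theta ^+ 2 / 2) x w.
Proof.
move=> h0 th0 x0.
apply: discounted_hit_le; rewrite ?hit_discount_ge0 ?(ltW x0)// => k _.
rewrite walk_increment => /ltW xk.
have hk0 : 0 <= h * k.+1%:R by rewrite mulr_ge0 // ltW.
have := first_passage_le hB x0 hk0 xk.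
have [->|[s [s0 Ts _]]] := first_passageP w x0; first by rewrite leye_eq.
rewrite Ts lee_fin (hit_discountE _ Ts) => sk.
rewrite /discount ler_expR lerN2 ler_wpM2l//.
exact: lambda_ge0 th0 (ltW a0).
Qed.

(** With mesh [p ^ -2] and [p ^ 3] steps the horizon is [p]. The Chernoff parameter is also [p]: its
    drift and Gaussian costs, of order [p h] and [p ^ 2 h], stay bounded, while the gain
    [exp (- p eps)] beats the number of steps. *)
Let p (m : nat) : R := m.+1%:R.
Let h (m : nat) : R := (p m ^+ 2)^-1.
Let n (m : nat) : nat := (m.+1 ^ 3)%N.

Let p_gt0 m : 0 < p m. Proof. by rewrite ltr0n. Qed.
Let p_ge1 m : 1 <= p m. Proof. by rewrite ler1n. Qed.
Let h_gt0 m : 0 < h m. Proof. by rewrite invr_gt0 exprn_gt0. Qed.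
Let hn m : h m * (n m)%:R = p m.
Proof. by rewrite /h /n natrX -/(p m); field; rewrite gt_eqF. Qed.

Let overshoot_error_small (theta x eps delta : R) : 0 < theta -> 0 < eps -> 0 < delta ->
  exists m, overshoot_error a (h m) theta x (n m) eps (p m) <= delta.
Proof.
move=> th0 e0 d0.
pose lambda := theta * a + theta ^+ 2 / 2.
have l0 : 0 < lambda by rewrite addr_gt0 ?mulr_gt0 ?exprn_gt0// invr_gt0.
(* [K] bounds the exponent, apart from [- p eps], uniformly in [m], because [1 <= p]. [C / p] then
   majorizes both error terms, the second through [exp (- q) <= 1 / q] at [q = lambda p]. *)
pose K := theta * x + (theta + 1) * a + (theta + 1) ^+ 2 / 2.
pose C := expR K * (4 / eps) ^+ 4 + expR (theta * x) / lambda.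
have C0 : 0 < C.
  apply: addr_gt0; last by rewrite divr_gt0 ?expR_gt0.
  by rewrite mulr_gt0 ?expR_gt0// exprn_gt0// divr_gt0.
have [m /ltW Cm] : exists m, C / p m < delta.
  exists (Num.truncn (C / delta)); rewrite ltr_pdivrMr// mulrC -ltr_pdivrMr//.
  by rewrite /p truncnS_gt.
exists m; apply: le_trans Cm.
have p0 := p_gt0 m; have p1 := p_ge1 m.
have pn0 : p m != 0 by rewrite gt_eqF.
rewrite /C mulrDl /overshoot_error lerD//; last first.
  rewrite hn expRD -mulrA ler_pM2l ?expR_gt0//.
  rewrite -/lambda expRN -invfM lef_pV2 ?posrE ?expR_gt0 ?mulr_gt0//.
  by apply: le_trans (expR_ge1Dx _); rewrite lerDr.
have ->  : (n m)%:R = p m ^+ 3 by rewrite /n natrX.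
apply: (@le_trans _ _ (p m ^+ 3 * (expR K * expR (- (p m * eps))))).
  rewrite ler_pM2l ?exprn_gt0// -expRD ler_expR /K.
  have H1 : (theta + p m) * (a * h m) <= (theta + 1) * a.
    rewrite mulrA -mulrA (mulrC a) mulrA ler_pM2r//.
    rewrite /h ler_pdivrMr ?exprn_gt0//.
    have : 0 <= theta * (p m ^+ 2 - 1) + p m * (p m - 1).
      by rewrite addr_ge0// mulr_ge0 ?(ltW th0) ?(ltW p0) ?subr_ge0// exprn_ege1.
    rewrite -[theta + p m <= _]subr_ge0.
    suff -> : (theta + 1) * p m ^+ 2 - (theta + p m) =
              theta * (p m ^+ 2 - 1) + p m * (p m - 1) by [].
    by ring.
  have H2 : (theta + p m) ^+ 2 * h m / 2 <= (theta + 1) ^+ 2 / 2.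
    rewrite ler_pM2r ?invr_gt0// /h ler_pdivrMr ?exprn_gt0//.
    rewrite -exprMn lerXn2r ?nnegrE ?addr_ge0 ?mulr_ge0 ?addr_ge0 ?(ltW th0) ?(ltW p0)//.
    by rewrite mulrDl mul1r lerD2r ler_peMr// ltW.
  rewrite [leLHS](_ : _ = theta * x + (theta + p m) * (a * h m) + (theta + p m) ^+ 2 * h m / 2 - p m * eps); last by ring.
  by rewrite lerD2r lerD// lerD2l.
rewrite mulrCA -mulrA ler_pM2l ?expR_gt0//.
(* The fourth power, one more than the exponent of [p ^ 3]: [exp (- p eps) <= (4 / (p eps)) ^ 4]
   leaves a factor [1 / p]. *)
have -> : - (p m * eps) = 4%:R * - (p m * eps / 4) by field.
rewrite expRM_natl expRN exprVn.
rewrite ler_pdivrMr ?exprn_gt0 ?expR_gt0//.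
have H : p m * eps / 4 <= expR (p m * eps / 4).
  by apply: le_trans (expR_ge1Dx _); rewrite lerDr.
apply: (@le_trans _ _ ((4 / eps) ^+ 4 / p m * (p m * eps / 4) ^+ 4)).
  have E (q : R) : q != 0 -> q ^+ 3 = (4 / eps) ^+ 4 / q * (q * eps / 4) ^+ 4.
    by move=> q0; field; rewrite q0 gt_eqF.
  by rewrite -E.
have pe0 : 0 <= p m * eps / 4 by rewrite !mulr_ge0 ?invr_ge0 ?(ltW p0) ?(ltW e0).
rewrite ler_wpM2l ?mulr_ge0 ?invr_ge0 ?exprn_ge0 ?divr_ge0 ?(ltW e0) ?(ltW p0)//.
by rewrite lerXn2r// nnegrE expR_ge0.
Qed.

Let integral_hit_discount_le1 (lambda x : R) : 0 <= lambda -> 0 < x ->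
  (\int[P]_w (hit_discount lambda x w)%:E <= 1)%E.
Proof.
move=> l0 x0.
have -> : (1 = \int[P]_w (cst 1%E w) :> \bar R)%E.
  by rewrite integral_cst// mul1e; apply/esym; exact: probability_setT.
apply: ge0_le_integral => //.
- by move=> w _; rewrite lee_fin hit_discount_ge0.
- by apply/measurable_EFinP; exact: measurable_hit_discount.
move=> w _; rewrite lee_fin.
have [/hit_discountNy ->//|[s [s0 /hit_discountE -> _]]] := first_passageP w x0.
by rewrite -expR0 ler_expR oppr_le0 mulr_ge0.
Qed.

Let ind_h m k : mutually_independent P (fun i : 'I_k => increment (h m) i).
Proof. exact: increment_independent (ltW (h_gt0 m)). Qed.

Let law_h m k : has_law P (increment (h m) k) (normal_prob 0 (Num.sqrt (h m))).
Proof. exact: increment_law. Qed.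

(** The passage of the path is discounted less than that of the walk, whose lower bound is explicit;
    the error vanishes with the mesh for fixed [eps], after which [eps] tends to 0. *)
Lemma hit_discount_integral_ge (theta x : R) : 0 < theta -> 0 < x ->
  ((expR (- (theta * x)))%:E <=
   \int[P]_w (hit_discount (theta * a + theta ^+ 2 / 2) x w)%:E)%E.
Proof.
move=> th0 x0; set lambda := theta * a + _.
have l0 : 0 <= lambda by rewrite addr_ge0 ?mulr_ge0 ?(ltW th0) ?(ltW a0) ?invr_ge0 ?sqr_ge0.
have I0 : (0 <= \int[P]_w (hit_discount lambda x w)%:E)%E.
  by apply: integral_ge0 => w _; rewrite lee_fin hit_discount_ge0.
have Ifin : (\int[P]_w (hit_discount lambda x w)%:E)%E \is a fin_num.
  by rewrite ge0_fin_numE// (le_lt_trans (integral_hit_discount_le1 l0 x0))// ltry.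
rewrite -(fineK Ifin) lee_fin; set L := fine _.
have L0 : 0 <= L by rewrite fine_ge0.
have H (eps : R) : 0 < eps -> 1 <= expR (theta * (x + eps)) * L.
  move=> e0; apply/ler_addgt0Pr => delta d0.
  have [m /= em] := overshoot_error_small x th0 e0 d0.
  apply: le_trans (lerD (lexx _) em).
  rewrite -lee_fin.
  have := discounted_hit_lower (xi := increment (h m)) (h_gt0 m) (ltW th0) (ltW x0)
    (ind_h m) (law_h m) (ltW a0) (n m) e0 (ltW (p_gt0 m)).
  move=> /le_trans; apply.
  rewrite [leRHS]EFinD [(_ * L)%:E]EFinM /L (fineK Ifin); apply: leeD => //.
  apply: lee_wpmul2l; first by rewrite lee_fin expR_ge0.
  apply: ge0_le_integral => //.
  - by move=> w _; rewrite lee_fin discounted_hit_ge0// ltW.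
  - by apply/measurable_EFinP; exact: measurable_discounted_hit.
  - by apply/measurable_EFinP; exact: measurable_hit_discount.
  - by move=> w _; rewrite lee_fin discounted_hit_le_hit// ltW.
apply/ler_addgt0Pr => e e0.
(* The overshoot [eps = e / theta] costs the factor [exp (- e)], which is at least [1 - e]. *)
have et0 : 0 < e / theta by rewrite divr_gt0.
have := H _ et0; rewrite mulrDr expRD [theta * (e / _)]mulrC divfK ?gt_eqF//.
rewrite -ler_pdivrMl ?mulr_gt0 ?expR_gt0// mulr1 invfM -!expRN => HL.
apply: le_trans (lerD HL (lexx e)).
rewrite -lerBlDr; apply: le_trans (_ : _ <= expR (- (theta * x)) * (1 - e)) _.
  rewrite mulrBr mulr1 lerD2l lerN2 ler_piMl ?(ltW e0)//.
  by rewrite -expR0 ler_expR oppr_le0 mulr_ge0 ?ltW.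
by rewrite ler_pM2l ?expR_gt0//; exact: expR_ge1Dx.
Qed.

(** The samples may miss a path that barely touches [x], but by continuity it is still above [y] at
    the first sampling time after its passage, once the mesh is fine. *)
Let eventually_discounted_hit (theta x y eps : R) w : 0 < theta -> 0 < y -> y < x -> 0 < eps ->
  exists M, forall m, (M <= m)%N ->
    expR (- eps) * hit_discount (theta * a + theta ^+ 2 / 2) x w <=
    discounted_hit (increment (h m)) a (h m) theta y (n m) w.
Proof.
move=> th0 y0 yx e0; set lambda := theta * a + _.
have l0 : 0 < lambda by rewrite addr_gt0 ?mulr_gt0 ?exprn_gt0// invr_gt0.
have x0 : 0 < x by exact: lt_trans yx.
have [Ty|[s [s0 Ts sx]]] := first_passageP w x0.
  exists 0%N => m _; rewrite (hit_discountNy _ Ty) mulr0 discounted_hit_ge0//.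
  exact: ltW.
have xy0 : 0 < x - y by rewrite subr_gt0.
have [del del0 Hd] := drifted_near a hB w s0 xy0.
(* The three bounds on [p] ensure in turn that the horizon exceeds [s], that the mesh is below
   [del], and that one step of discount costs at most [eps]. *)
pose M := Num.truncn (Num.max (s + 1) (Num.max del^-1 (lambda / eps))).
exists M => m Mm.
have pM : Num.max (s + 1) (Num.max del^-1 (lambda / eps)) < p m.
  apply: lt_le_trans (truncnS_gt _) _.
  by rewrite ler_nat ltnS.
move: pM; rewrite !gt_max => /and3P[ps pdel plam].
have hp : h m <= (p m)^-1.
  by rewrite /h lef_pV2 ?posrE ?exprn_gt0// expr2 ler_peMr// ltW.
(* The last sampling time not after [s]; the next one serves as witness of the hit. *)
pose k := Num.truncn (s / h m).
have /andP[k1 k2] : k%:R <= s / h m < k.+1%:R.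
  by rewrite truncn_itv// divr_ge0 ?(ltW (h_gt0 m)).
rewrite ler_pdivlMr// mulrC in k1; rewrite ltr_pdivrMr// mulrC in k2.
have k3 : h m * k.+1%:R <= s + h m by rewrite -natr1 mulrDr mulr1 lerD2r.
have kn : (k < n m)%N.
  rewrite -(ltr_nat R) -(ltr_pM2l (h_gt0 m)) hn.
  by apply: le_lt_trans k1 _; apply: lt_trans ps; rewrite ltrDl.
have yk : y < walk (increment (h m)) a (h m) k.+1 w.
  rewrite walk_increment.
  have hk0 : 0 <= h m * k.+1%:R by rewrite mulr_ge0// ltW.
  have /(Hd _ hk0) : `|s - h m * k.+1%:R| < del.
    rewrite distrC ger0_norm ?subr_ge0 ?(ltW k2)// ltrBlDl.
    apply: le_lt_trans k3 _; rewrite ltrD2l; apply: le_lt_trans hp _.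
    by rewrite invf_plt ?posrE.
  by rewrite sx => /ltr_distlDr; rewrite -ltrBlDr opprB addrCA subrr addr0.
have := discounted_hit_ge (h_gt0 m) (ltW th0) (ltW y0) (ltW a0) kn yk.
apply: le_trans; rewrite (hit_discountE _ Ts) -expRD ler_expR -opprD lerN2.
apply: le_trans (ler_wpM2l (ltW l0) k3) _.
rewrite mulrDr addrC lerD2r; apply: le_trans (ler_wpM2l (ltW l0) hp) _.
by rewrite ler_pdivrMr// mulrC -ler_pdivrMr// ltW.
Qed.

(** The pathwise bound holds from an index that depends on the path, whereas the bound on the
    expectations is uniform: exactly the setting of Fatou's lemma. *)
Let hit_discount_fatou (theta x y eps : R) : 0 < theta -> 0 < y -> y < x -> 0 < eps ->
  ((expR (- eps))%:E * \int[P]_w (hit_discount (theta * a + theta ^+ 2 / 2) x w)%:E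
   <= (expR (- (theta * y)))%:E)%E.
Proof.
move=> th0 y0 yx e0; set lambda := theta * a + _.
have x0 : 0 < x by exact: lt_trans yx.
pose D m w := discounted_hit (increment (h m)) a (h m) theta y (n m) w.
have mD m : measurable_fun setT (fun w => (D m w)%:E).
  by apply/measurable_EFinP; exact: measurable_discounted_hit.
have D0 m w : (0 <= (D m w)%:E)%E.
  by rewrite lee_fin discounted_hit_ge0// ltW.
have mhit := measurable_hit_discount lambda x0.
rewrite -ge0_integralZl_EFin ?expR_ge0//; last 2 first.
- by move=> w _; rewrite lee_fin hit_discount_ge0.
- exact/measurable_EFinP.
apply: (@le_trans _ _ (\int[P]_w limn_einf (fun m => (D m w)%:E))%E).
  apply: ge0_le_integral => //.
  - by move=> w _; rewrite -EFinM lee_fin mulr_ge0 ?expR_ge0 ?hit_discount_ge0.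
  - under eq_fun do rewrite -EFinM.
    by apply/measurable_EFinP/measurable_funM.
  - apply: (emeasurable_fun_cvg (fun M w => einfs (fun m => (D m w)%:E) M)).
      by move=> M; exact: measurable_fun_einfs.
    by move=> w _; rewrite limn_einf_lim; exact: is_cvg_einfs.
  move=> w _; have [M HM] := eventually_discounted_hit w th0 y0 yx e0.
  apply: (@le_trans _ _ (einfs (fun m => (D m w)%:E) M)).
    apply: le_ereal_inf_tmp => _ [m /= Mm <-].
    by rewrite -EFinM lee_fin; exact: HM.
  rewrite limn_einf_lim; apply: lime_ge; first exact: is_cvg_einfs.
  by exists M => // m /= Mm; exact: nondecreasing_einfs.
apply: (le_trans (fatou P measurableT mD (fun m w _ => D0 m w))).
rewrite limn_einf_lim; apply: lime_le; first exact: is_cvg_einfs.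
apply: nearW => m.
apply: (@le_trans _ _ (\int[P]_w (D m w)%:E)%E).
  by apply: ereal_inf_lbound; exists m => //=.
exact: (discounted_hit_upper (xi := increment (h m)) a (h_gt0 m) (ltW th0)
    (ltW y0) (ind_h m) (law_h m)).
Qed.

Lemma integral_hit_discount (theta x : R) : 0 < theta -> 0 < x ->
  (\int[P]_w (hit_discount (theta * a + theta ^+ 2 / 2) x w)%:E =
   (expR (- (theta * x)))%:E)%E.
Proof.
move=> th0 x0; have := hit_discount_integral_ge th0 x0.
have l0 : 0 <= theta * a + theta ^+ 2 / 2.
  by rewrite addr_ge0 ?mulr_ge0 ?(ltW th0) ?(ltW a0) ?invr_ge0 ?sqr_ge0.
have I0 : (0 <= \int[P]_w (hit_discount (theta * a + theta ^+ 2 / 2) x w)%:E)%E.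
  by apply: integral_ge0 => w _; rewrite lee_fin hit_discount_ge0.
have Ifin : (\int[P]_w (hit_discount (theta * a + theta ^+ 2 / 2) x w)%:E)%E \is a fin_num.
  by rewrite ge0_fin_numE// (le_lt_trans (integral_hit_discount_le1 l0 x0))// ltry.
(* [eta] is both the gap between the levels [x - eta] and [x] and the loss [eps] in the discount. *)
have H (eta : R) : 0 < eta -> eta < x ->
    fine (\int[P]_w (hit_discount (theta * a + theta ^+ 2 / 2) x w)%:E)%E <=
    expR (- (theta * x) + (1 + theta) * eta).
  move=> e0 ex.
  have xe0 : 0 < x - eta by rewrite subr_gt0.
  have xex : x - eta < x by rewrite gtrBl.
  have := hit_discount_fatou th0 xe0 xex e0.
  rewrite -[X in (_ * X <= _)%E](fineK Ifin) -EFinM lee_fin expRN mulrC.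
  rewrite ler_pdivrMr ?expR_gt0// -expRD.
  by congr (_ <= expR _); ring.
move: Ifin H => /fineK <-; set L := fine _ => H; rewrite lee_fin => LL.
congr EFin; apply/eqP; rewrite eq_le LL andbT leNgt; apply/negP => Llt.
have L0 : 0 < L by apply: lt_trans Llt; exact: expR_gt0.
have lnL : - (theta * x) < ln L by rewrite -ltr_expR lnK ?posrE.
(* The first bound keeps the lower level positive; the second makes [(1 + theta) * eta] at most half
   of the supposed gap between the logarithms. *)
pose eta := Num.min (x / 2) ((ln L + theta * x) / (2 * (1 + theta))).
have lp : 0 < ln L + theta * x by rewrite -(opprK (theta * x)) subr_gt0.
have th1 : 0 < 1 + theta by rewrite addr_gt0.
have eta0 : 0 < eta by rewrite lt_min !divr_gt0// mulr_gt0.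
have etax : eta < x.
  by rewrite gt_min ltr_pdivrMr// ltr_pMr// ltr1n.
have := H eta eta0 etax; rewrite leNgt => /negP; apply.
rewrite -[ltRHS](lnK (_ : L \is Num.pos)) ?posrE// ltr_expR.
rewrite addrC -ltrBrDr opprK.
apply: (@le_lt_trans _ _ ((ln L + theta * x) / 2)); last first.
  by rewrite ltr_pdivrMr// ltr_pMr// ltr1n.
apply: (@le_trans _ _ ((1 + theta) * ((ln L + theta * x) / (2 * (1 + theta))))).
  by rewrite ler_pM2l// ge_min lexx orbT.
by rewrite le_eqVlt; apply/orP; left; apply/eqP; field; rewrite gt_eqF.
Qed.

(** The probability of passage dominates every Laplace value [exp (- theta x)], and these tend to 1
    with [theta] to 0; [theta = e / x] gives at least [1 - e]. *)
Lemma first_passage_finite (x : R) : 0 < x -> P [set w | (fpt x w < +oo)%E] = 1%E.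
Proof.
move=> x0.
have mT := measurable_first_passage a hB x0.
have mA : measurable [set w | (fpt x w < +oo)%E].
  by rewrite -[X in measurable X]setTI; exact: emeasurable_fun_infty_o.
apply/eqP; rewrite eq_le probability_le1//=.
have Pfin : P [set w | (fpt x w < +oo)%E] \is a fin_num by exact: fin_num_measure.
rewrite -(fineK Pfin) lee_fin; set q := fine _.
apply/ler_addgt0Pr => e e0.
have th0 : 0 < e / x by rewrite divr_gt0.
have l0 : 0 <= (e / x) * a + (e / x) ^+ 2 / 2.
  by rewrite addr_ge0 ?mulr_ge0 ?(ltW th0) ?(ltW a0) ?invr_ge0 ?sqr_ge0 ?(ltW x0) ?(ltW e0).
have : ((expR (- (e / x * x)))%:E <= P [set w | (fpt x w < +oo)%E])%E.
  rewrite -(integral_hit_discount th0 x0).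
  rewrite -[X in P X]setIT -integral_indic//.
  apply: ge0_le_integral => //.
  - by move=> w _; rewrite lee_fin hit_discount_ge0.
  - by apply/measurable_EFinP; exact: measurable_hit_discount.
  - exact/measurable_EFinP/measurable_indic.
  move=> w _; rewrite lee_fin.
  have [Ty|[s [s0 Ts _]]] := first_passageP w x0.
    by rewrite hit_discountNy.
  rewrite (hit_discountE _ Ts) indicE mem_set/= ?Ts ?ltry//.
  by rewrite -[leRHS]expR0 ler_expR oppr_le0 mulr_ge0.
rewrite divfK ?gt_eqF// -(fineK Pfin) lee_fin -/q => H.
rewrite -lerBlDr; apply: le_trans H.
exact: expR_ge1Dx.
Qed.

End first_passage_laplace.

Section first_passage_law.
Context {R : realType} {d : measure_display} {T : measurableType d}.
Variables (P : probability T R) (B : R -> {RV P >-> R}) (a : R).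
Hypotheses (hB : standard_brownian_motion B) (a0 : 0 < a).

Definition passage_exponent (x lambda : R) : R :=
  x * (Num.sqrt (a ^+ 2 + 2 * lambda) - a).

(** By almost sure finiteness the real-valued [fine] of the passage time carries the whole law;
    pushing it forward along [EFin] returns to the extended reals. *)
Lemma first_passage_lawP (x : R) : 0 < x ->
  exists mu : probability R R,
  [/\ has_law P (first_passage_time B a x) (pushforward mu (@EFin R)),
      mu `]-oo, 0[%classic = 0%E &
      forall lambda, 0 <= lambda ->
        laplace_transform mu lambda = (expR (- passage_exponent x lambda))%:E].
Proof.
move=> x0.
have mT := measurable_first_passage a hB x0.
have mf : measurable_fun setT (fun w => fine (first_passage_time B a x w)).
  exact: measurableT_comp.
pose X : {RV P >-> R} := mfun_Sub (mem_set mf).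
pose F := [set w | (first_passage_time B a x w < +oo)%E].
have mF : measurable F.
  by rewrite -[X in measurable X]setTI; exact: emeasurable_fun_infty_o.
have PF : P (~` F) = 0%E.
  by rewrite probability_setC// first_passage_finite// subee.
have TF w : F w -> first_passage_time B a x w = (X w)%:E.
  by move=> Fw; rewrite /X/= fineK// ge0_fin_numE// first_passage_ge0.
have PI (A : set T) : measurable A -> P A = P (A `&` F).
  move=> mA; rewrite (measureDI P mA mF).
  rewrite [X in (X + _)%E](_ : _ = 0%E) ?add0e//.
  apply/eqP; rewrite eq_le measure_ge0 andbT -PF.
  have mAF : measurable (A `\` F) by exact: measurableD.
  have mCF : measurable (~` F) by exact: measurableC.
  by apply: le_measure; rewrite ?inE// => w [].
exists (distribution P X); split.
- split; first exact: mT.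
  move=> A mA.
  have mTA : measurable (first_passage_time B a x @^-1` A).
    by rewrite -[X in measurable X]setTI; exact: mT.
  have mEA : measurable (EFin @^-1` A).
    by rewrite -[X in measurable X]setTI; exact: EFin_measurable.
  have mXA : measurable (X @^-1` (EFin @^-1` A)).
    by rewrite -[X in measurable X]setTI; exact: measurable_funP.
  rewrite [LHS]PI//.
  have -> : pushforward (distribution P X) EFin A = P (X @^-1` (EFin @^-1` A)) by [].
  rewrite [RHS]PI//; congr (P _); apply/seteqP; split => w /= [Aw Fw]; split => //.
    by rewrite -TF.
  by rewrite TF.
- change (P (X @^-1` `]-oo, 0[%classic) = 0%E).
  rewrite (_ : X @^-1` _ = set0) ?measure0//.
  apply/seteqP; split => // w /=; rewrite in_itv/= ltNge.
  by rewrite fine_ge0// first_passage_ge0.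
move=> lambda l0.
rewrite /laplace_transform ge0_integral_distribution//; last first.
  by apply/measurable_EFinP; apply: measurableT_comp => //; apply: measurableT_comp => //.
(* The nonnegative root of [theta ^ 2 / 2 + theta a = lambda]. It vanishes at [lambda = 0], where
   the transform is the total mass. *)
pose theta := Num.sqrt (a ^+ 2 + 2 * lambda) - a.
have [l00|ln0] := eqVneq lambda 0.
  rewrite l00 /passage_exponent mulr0 addr0 sqrtr_sqr gtr0_norm// subrr mulr0 oppr0.
  under eq_integral do rewrite /= mul0r oppr0.
  rewrite expR0 integral_cst// mul1e; exact: probability_setT.
have lgt : 0 < lambda by rewrite lt_neqAle eq_sym ln0.
have s2 : Num.sqrt (a ^+ 2 + 2 * lambda) ^+ 2 = a ^+ 2 + 2 * lambda.
  by rewrite sqr_sqrtr// addr_ge0 ?sqr_ge0 ?mulr_ge0.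
have th0 : 0 < theta.
  rewrite subr_gt0 -[ltLHS](ger0_norm (ltW a0)) -sqrtr_sqr ltr_sqrt ?ltrDl ?mulr_gt0//.
  by rewrite addr_gt0 ?exprn_gt0 ?mulr_gt0.
have lE : lambda = theta * a + theta ^+ 2 / 2.
  rewrite /theta; move: s2; set s := Num.sqrt _ => s2.
  have -> : (s - a) * a + (s - a) ^+ 2 / 2 = (s ^+ 2 - a ^+ 2) / 2 by field.
  by rewrite s2; field.
rewrite /passage_exponent mulrC -/theta -(integral_hit_discount hB a0 th0 x0) -lE.
apply: ge0_ae_eq_integral => //.
- apply/measurable_EFinP; apply: measurableT_comp => //; apply: measurableT_comp => //.
  by apply: measurable_funM => //; exact: mf.
- by apply/measurable_EFinP; exact: measurable_hit_discount.
- by move=> w _; rewrite lee_fin expR_ge0.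
- by move=> w _; rewrite lee_fin hit_discount_ge0.
exists (~` F); split => //; first exact: measurableC.
move=> w /= H Fw; apply: H => _.
by rewrite (hit_discountE _ (TF _ Fw)).
Qed.

End first_passage_law.

(** * Gamma distributions *)

Section lebesgue_half_line.
Context {R : realType}.
Notation leb := (@lebesgue_measure R).

(** The integrand may blow up at [b], as the Thorin density does, so the fundamental theorem is
    applied from [b + n.+1%:R^-1] on and monotone convergence lets [n] grow. *)
Lemma ge0_FTC_half_line (f F : R -> R) (b l0 l : R) :
    (forall t, b < t -> 0 <= f t) ->
    (forall t, b < t -> {for t, continuous f}) ->
    (forall t, b < t -> is_derive t 1 F (f t)) ->
    F t @[t --> b^'+] --> l0 -> F t @[t --> +oo] --> l ->
  (\int[leb]_(t in `]b, +oo[) (f t)%:E = (l - l0)%:E)%E.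
Proof.
move=> f0 cf dF Fb Fy.
pose c (n : nat) : R := b + n.+1%:R^-1.
have bc n : b < c n by rewrite ltrDl invr_gt0.
pose A n := `[c n, +oo[%classic : set R.
have UA : \bigcup_n A n = `]b, +oo[%classic.
  apply/seteqP; split => [t [n _]|t].
    by rewrite /A /= !in_itv/= !andbT; exact: lt_le_trans.
  rewrite /= in_itv/= andbT => bt; exists (Num.truncn (t - b)^-1) => //.
  rewrite /A/= in_itv/= andbT /c -lerBrDl.
  have tb : 0 < t - b by rewrite subr_gt0.
  by rewrite invf_ple ?posrE// ltW// truncnS_gt.
have cW n : {within A n, continuous f}.
  by apply: continuous_in_subspaceT => t; rewrite inE /A/= in_itv/= andbT => ct;
    apply: cf; exact: lt_le_trans ct.
have IA n : (\int[leb]_(t in A n) (f t)%:E = l%:E - (F (c n))%:E)%E.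
  apply: ge0_continuous_FTC2y => //.
  - by move=> t ct; apply: f0; exact: lt_le_trans ct.
  - exact: cW.
  - by move=> t ct; have [] := dF t (lt_trans (bc n) ct).
  - apply: cvg_at_right_filter.
    have [dc _] := dF _ (bc n).
    by move: dc => /derivable1_diffP/differentiable_continuous.
  - move=> t; rewrite in_itv/= andbT => ct; rewrite derive1E.
    by have [_] := dF t (lt_trans (bc n) ct).
have H1 : (\int[leb]_(t in A n) (f t)%:E)%E @[n --> \oo] -->
    (\int[leb]_(t in `]b, +oo[) (f t)%:E)%E.
  rewrite -UA; apply: ge0_nondecreasing_set_cvg_integral => //.
  - apply/nondecreasing_seqP => n; rewrite subsetEset => t.
    rewrite /A/= !in_itv/= !andbT; apply: le_trans.
    by rewrite /c lerD2l lef_pV2 ?posrE// ler_nat.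
  - by move=> n; exact: measurable_itv.
  - move=> n; apply/measurable_EFinP.
    by apply: subspace_continuous_measurable_fun => //; exact: measurable_itv.
  - move=> n t; rewrite /A/= in_itv/= andbT => ct; rewrite lee_fin f0//.
    exact: lt_le_trans ct.
have H2 : (\int[leb]_(t in A n) (f t)%:E)%E @[n --> \oo] --> (l - l0)%:E.
  have -> : (fun n => \int[leb]_(t in A n) (f t)%:E)%E = (fun n => (l - F (c n))%:E).
    by apply/funext => n; rewrite IA EFinB.
  apply: cvg_EFin; first by apply: nearW.
  apply: cvgB; first exact: cvg_cst.
  move/cvg_at_rightP : Fb; apply; split; first by move=> n; exact: bc.
  rewrite -[X in _ --> X](addr0 b); apply: cvgD; first exact: cvg_cst.
  exact: cvg_harmonic.
exact: (cvg_unique _ H1 H2).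
Qed.

Let scale (s : R) : measurableTypeR R -> measurableTypeR R := *%R s.

Let measurable_scale s : measurable_fun setT (scale s).
Proof. exact: mulrl_measurable. Qed.

Lemma lebesgue_measure_scale (s : R) (s0 : 0 < s) (A : set R) : measurable A ->
  leb A = (s%:E * leb (scale s @^-1` A))%E.
Proof.
move=> mA.
have mS := measurable_scale s.
rewrite (@lebesgue_measure_unique _ (mscale (NngNum (ltW s0)) (pushforward leb (scale s))))//.
move=> _ [[a b] _ <-]/=.
rewrite /mscale/= /pushforward.
have -> : scale s @^-1` `]a, b]%classic = `]a / s, b / s]%classic.
  apply/seteqP; split => t /=; rewrite /scale !in_itv/= ltr_pdivrMr// ler_pdivlMr//.
    by rewrite mulrC.
  by rewrite (mulrC t).
rewrite !lebesgue_measure_itv/= !lte_fin ltr_pM2r ?invr_gt0//.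
case: ifP => _; last by rewrite mule0.
by rewrite -!EFinB -EFinM; congr EFin; field; rewrite gt_eqF.
Qed.

Lemma ge0_integral_scale (s : R) (f : R -> \bar R) : 0 < s ->
    measurable_fun (`]0, +oo[%classic : set R) f -> (forall t, 0 < t -> (0 <= f t)%E) ->
  (\int[leb]_(t in `]0%R, +oo[) f t =
   s%:E * \int[leb]_(t in `]0%R, +oo[) f (s * t)%R)%E.
Proof.
move=> s0 mf f0.
have mS := measurable_scale s.
have PE : scale s @^-1` `]0, +oo[%classic = `]0, +oo[%classic.
  by apply/seteqP; split => t /=; rewrite /scale !in_itv/= !andbT pmulr_rgt0.
transitivity (s%:E * \int[leb]_(t in scale s @^-1` `]0%R, +oo[) (f \o scale s) t)%E; last first.
  by rewrite PE.
have f0' t : t \in (`]0, +oo[%classic : set R) -> (0 <= f t)%E.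
  by rewrite inE/= in_itv/= andbT; exact: f0.
have f0'' t : (`]0, +oo[%classic : set R) t -> (0 <= f t)%E.
  by rewrite /= in_itv/= andbT; exact: f0.
rewrite -(ge0_integral_pushforward mS leb (measurable_itv _) mf f0').
have mf' : measurable_fun (`]0, +oo[%classic : set (measurableTypeR R)) f by [].
have mI : measurable (`]0, +oo[%classic : set (measurableTypeR R)) by exact: measurable_itv.
apply: etrans; last first.
  exact: (ge0_integral_mscale _ mI (NngNum (ltW s0)) mf' f0'').
by apply: eq_measure_integral => A mA _; exact: lebesgue_measure_scale.
Qed.

End lebesgue_half_line.

(** * The gamma integral *)

Section gamma_integral.
Context {R : realType} (omega : R).
Hypothesis omega0 : 0 < omega.
Notation leb := (@lebesgue_measure R).
Notation half_line := (`]0%R, +oo[%classic : set R).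

Let kernel (t : R) : R := t `^ (omega - 1) * expR (- t).

Let kernel_ge0 t : 0 <= kernel t.
Proof. by rewrite mulr_ge0 ?powR_ge0 ?expR_ge0. Qed.

Let measurable_kernel (D : set R) : measurable_fun D kernel.
Proof.
apply: measurable_funTS; apply: measurable_funM; first exact: measurable_powR.
by apply: measurableT_comp.
Qed.

(** A bounded primitive whose derivative is of order [t ^ (omega - 1)] at 0 and decays polynomially
    at infinity: it controls the kernel at both ends without splitting the half-line. *)
Let majorant (t : R) : R := 1 - (1 + t `^ omega)^-1.

Let majorant_den_gt0 t : 0 < 1 + t `^ omega.
Proof. by rewrite ltr_pwDl// powR_ge0. Qed.

Let is_derive_majorant (t : R) : 0 < t ->
  is_derive t 1 majorant (omega * t `^ (omega - 1) / (1 + t `^ omega) ^+ 2).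
Proof.
move=> t0; have d0 := majorant_den_gt0 t.
have H : is_derive t 1 (fun y : R => 1 + y `^ omega) (0 + omega * t `^ (omega - 1)).
  by apply: is_deriveD; exact: is_derive1_powR.
have dn0 : 1 + t `^ omega != 0 by rewrite gt_eqF.
have HV : is_derive t 1 (fun y : R => (1 + y `^ omega)^-1)
    (- (1 + t `^ omega) ^- 2 *: (0 + omega * t `^ (omega - 1))).
  exact: is_deriveV.
have HB : is_derive t 1 majorant
    (0 - (- (1 + t `^ omega) ^- 2 *: (0 + omega * t `^ (omega - 1)))).
  exact: is_deriveB.
apply: is_derive_eq.
by rewrite !add0r scaleNr opprK [RHS]mulrC.
Qed.

Let kernel_le_majorant (t : R) : 0 < t ->
  kernel t <= (1 + (2 * omega) `^ omega) ^+ 2 / omega *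
    (omega * t `^ (omega - 1) / (1 + t `^ omega) ^+ 2).
Proof.
move=> t0; have d0 := majorant_den_gt0 t.
have o2 : 0 < 2 * omega by rewrite mulr_gt0.
(* The constant comes from [q <= exp q] at [q = t / (2 omega)], raised to the power [omega].
   Squaring then turns [expR (t / 2)] into [expR t]. *)
have H : 1 + t `^ omega <= (1 + (2 * omega) `^ omega) * expR (t / 2).
  rewrite mulrDl mul1r lerD//.
    by rewrite -[leLHS]expR0 ler_expR divr_ge0// ltW.
  have {1}-> : t = 2 * omega * (t / (2 * omega)) by field; rewrite gt_eqF.
  rewrite powRM ?divr_ge0 ?(ltW o2) ?(ltW t0)//.
  rewrite ler_wpM2l ?powR_ge0//.
  have -> : t / 2 = t / (2 * omega) * omega by field; rewrite gt_eqF.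
  rewrite expRM; apply: ge0_ler_powR; rewrite ?nnegrE ?expR_ge0 ?divr_ge0 ?(ltW o2) ?(ltW t0) ?(ltW omega0)//.
  by apply: le_trans (expR_ge1Dx _); rewrite lerDr.
set C := 1 + (2 * omega) `^ omega in H *.
rewrite [leRHS](_ : _ = t `^ (omega - 1) * (C ^+ 2 / (1 + t `^ omega) ^+ 2)); last first.
  by field; rewrite !gt_eqF.
rewrite /kernel ler_wpM2l ?powR_ge0//.
rewrite expRN ler_pdivlMr ?exprn_gt0// ler_pdivrMl ?expR_gt0//.
have -> : expR t * C ^+ 2 = (C * expR (t / 2)) ^+ 2.
  by rewrite exprMn -expRM_natl mulrC; congr (_ * expR _); field.
rewrite lerXn2r ?nnegrE ?(ltW d0)// mulr_ge0 ?expR_ge0// addr_ge0 ?powR_ge0//.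
Qed.

Let cvg_majorant0 : majorant t @[t --> (0 : R)^'+] --> (0 : R).
Proof.
rewrite [X in _ --> X](_ : _ = 1 - (1 + 0)^-1); last by rewrite addr0 invr1 subrr.
apply: cvgB; first exact: cvg_cst.
apply: cvgV; first by rewrite addr0 oner_eq0.
apply: cvgD; first exact: cvg_cst.
exact: powR_cvg0.
Qed.

Let cvg_majorant_pinfty : majorant t @[t --> +oo] --> (1 : R).
Proof.
apply/cvgrPdist_le => e e0.
exists (e^-1 `^ omega^-1); split; first exact: num_real.
move=> t et; rewrite /majorant opprB addrC subrK ger0_norm ?invr_ge0 ?(ltW (majorant_den_gt0 t))//.
have e10 : 0 < e^-1 by rewrite invr_gt0.
rewrite invf_ple ?posrE//; apply: (@le_trans _ _ (t `^ omega)); last by rewrite lerDr.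
have {1}-> : e^-1 = (e^-1 `^ omega^-1) `^ omega.
  by rewrite -powRrM mulVf ?gt_eqF// powRr1// ltW.
apply: ge0_ler_powR; rewrite ?nnegrE ?powR_ge0 ?(ltW omega0) ?(ltW et)//.
by rewrite (le_trans (powR_ge0 _ _) (ltW et)).
Qed.

Lemma gamma_integral_lty : (\int[leb]_(t in half_line) (kernel t)%:E < +oo)%E.
Proof.
pose C := (1 + (2 * omega) `^ omega) ^+ 2 / omega.
have C0 : 0 <= C by rewrite divr_ge0 ?sqr_ge0// ltW.
pose g (t : R) := omega * t `^ (omega - 1) / (1 + t `^ omega) ^+ 2.
have g0 t : 0 <= g t.
  by rewrite divr_ge0 ?sqr_ge0// mulr_ge0 ?powR_ge0// ltW.
have cp r t : 0 < t -> {for t, continuous (fun t : R => t `^ r)}.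
  move=> t0; apply/differentiable_continuous/derivable1_diffP.
  by have [] := is_derive1_powR r t0.
have cg t : 0 < t -> {for t, continuous g}.
  move=> t0; apply: cvgM.
    by apply: cvgM; [exact: cvg_cst|exact: cp].
  apply: cvgV; first by rewrite expf_neq0// gt_eqF// majorant_den_gt0.
  apply: (cvg_comp (fun t => 1 + t `^ omega) (fun t => t ^+ 2)); last exact: exprn_continuous.
  by apply: cvgD; [exact: cvg_cst|exact: cp].
have mg : measurable_fun half_line g.
  apply: open_continuous_measurable_fun; first exact: interval_open.
  by move=> t; rewrite inE/= in_itv/= andbT; exact: cg.
have Ig : (\int[leb]_(t in half_line) (g t)%:E = (1 - 0)%:E)%E.
  apply: (ge0_FTC_half_line _ cg is_derive_majorant cvg_majorant0 cvg_majorant_pinfty).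
  by move=> t _.
apply: (@le_lt_trans _ _ (\int[leb]_(t in half_line) (C * g t)%:E)%E).
  apply: ge0_le_integral => //.
  - by move=> t _; rewrite lee_fin kernel_ge0.
  - by apply/measurable_EFinP; exact: measurable_kernel.
  - by apply/measurable_EFinP; exact: measurable_funM.
  - by move=> t; rewrite /= in_itv/= andbT => t0; rewrite lee_fin kernel_le_majorant.
under eq_integral do rewrite EFinM.
rewrite ge0_integralZl_EFin//; last 2 first.
- by move=> t _; rewrite lee_fin.
- exact/measurable_EFinP.
by rewrite Ig -EFinM ltry.
Qed.

(** [Gamma_fun] is the finite part of this integral and would be 0 if it diverged, hence the
    finiteness proved just before. *)
Lemma gamma_integralE : (\int[leb]_(t in half_line) (kernel t)%:E = (Gamma_fun omega)%:E)%E.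
Proof.
rewrite /Gamma_fun /Rintegral fineK// ge0_fin_numE; first exact: gamma_integral_lty.
by apply: integral_ge0 => t _; rewrite lee_fin kernel_ge0.
Qed.

Lemma Gamma_fun_gt0 : 0 < Gamma_fun omega.
Proof.
rewrite -lte_fin -gamma_integralE.
(* A lower bound of the kernel on [1, 2], valid for all [omega] since [t ^ (omega - 1) >= 1 / t]
   there. *)
have c0 : 0 < 2^-1 * expR (- 2) :> R by rewrite mulr_gt0 ?expR_gt0// invr_gt0.
apply: (@lt_le_trans _ _ (\int[leb]_(t in `[1%R, 2%R]) (cst (2^-1 * expR (- 2))%:E) t)%E).
  rewrite integral_cst//=; rewrite [leb _]lebesgue_measure_itv/= lte_fin ltr1n.
  by rewrite -EFinB -EFinM lte_fin mulr_gt0// subr_gt0 ltr1n.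
apply: (@le_trans _ _ (\int[leb]_(t in `[1%R, 2%R]) (kernel t)%:E)%E); last first.
  apply: ge0_subset_integral => //.
  - by apply/measurable_EFinP; exact: measurable_kernel.
  - by move=> t _; rewrite lee_fin kernel_ge0.
  - by move=> t /=; rewrite !in_itv/= andbT => /andP[t1 _]; exact: lt_le_trans t1.
apply: ge0_le_integral => //.
- by move=> t _; rewrite lee_fin ltW.
- by apply/measurable_EFinP; exact: measurable_kernel.
move=> t /=; rewrite in_itv/= => /andP[t1 t2]; rewrite lee_fin ler_pM ?expR_ge0 ?invr_ge0//.
- apply: (@le_trans _ _ (t `^ (-1))).
    rewrite powR_inv1 ?(le_trans _ t1)// lef_pV2 ?posrE//.
    exact: lt_le_trans t1.
  by apply: ler_powR => //; rewrite lerBrDr addNr ltW.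
- by rewrite ler_expR lerN2.
Qed.

Lemma gamma_integral_scale (s : R) : 0 < s ->
  (\int[leb]_(t in half_line) (t `^ (omega - 1) * expR (- (s * t)))%:E =
   (Gamma_fun omega * expR (- (omega * ln s)))%:E)%E.
Proof.
move=> s0.
have sw : s `^ omega = expR (omega * ln s).
  by rewrite /powR gt_eqF.
suff H : ((s `^ omega)%:E *
   \int[leb]_(t in half_line) (t `^ (omega - 1) * expR (- (s * t)))%:E =
   (Gamma_fun omega)%:E)%E.
  rewrite EFinM -H sw expRN muleC muleA -EFinM mulVf ?mul1e//.
  by rewrite gt_eqF// expR_gt0.
rewrite -gamma_integralE [RHS](ge0_integral_scale s0); last 2 first.
- by apply/measurable_EFinP; exact: measurable_kernel.
- by move=> t _; rewrite lee_fin kernel_ge0.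
rewrite -(mulr_powRB1 (ltW s0) omega0) EFinM -muleA; congr (_ * _)%E.
rewrite -ge0_integralZl_EFin ?powR_ge0//; last 2 first.
- by move=> t _; rewrite lee_fin mulr_ge0 ?powR_ge0 ?expR_ge0.
- apply/measurable_EFinP/measurable_funTS/measurable_funM; first exact: measurable_powR.
  by apply: measurableT_comp => //; apply: measurableT_comp.
apply: eq_integral => t; rewrite inE/= in_itv/= andbT => t0.
by rewrite -EFinM; congr EFin; rewrite /kernel powRM ?(ltW s0) ?(ltW t0)// mulrA.
Qed.

End gamma_integral.

Section gamma_probability.
Context {R : realType} (omega : R).
Hypothesis omega0 : 0 < omega.

(** Taken at rate 1: the other rates come from the weights of the linear combinations, [k] times
    such a variable having rate [1 / k]. *)
Let G : set R -> \bar R := gamma_law omega 1.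

Let pdf_ge0 t : 0 <= gamma_pdf omega 1 t.
Proof.
by rewrite /gamma_pdf !mulr_ge0 ?powR_ge0 ?expR_ge0// invr_ge0 ltW// Gamma_fun_gt0.
Qed.

Let pdfE t : gamma_pdf omega 1 t =
  (Gamma_fun omega)^-1 * (t `^ (omega - 1) * expR (- t)).
Proof. by rewrite /gamma_pdf powR1 !mul1r mulrA. Qed.

Let measurable_pdf D : measurable_fun D (gamma_pdf omega 1).
Proof.
apply: measurable_funTS; apply: measurable_funM.
  by apply: measurable_funM => //; exact: measurable_powR.
by apply: measurableT_comp => //; apply: measurableT_comp.
Qed.

Let G0 : G set0 = 0%E.
Proof. by rewrite /G /gamma_law set0I integral_set0. Qed.

Let G_ge0 A : (0 <= G A)%E.
Proof. by apply: integral_ge0 => t _; rewrite lee_fin pdf_ge0. Qed.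

Let G_sigma_additive : semi_sigma_additive G.
Proof.
move=> /= A mA tA mUA; rewrite /G /gamma_law setI_bigcupl.
rewrite ge0_integral_bigcup//=; last 4 first.
- by move=> n; apply: (measurableI _ _ (mA n)).
- by apply/measurable_EFinP; exact: measurable_pdf.
- by move=> t _; rewrite lee_fin pdf_ge0.
- exact: trivIset_setIr.
by apply: is_cvg_ereal_nneg_natsum_cond => n _ _; exact: G_ge0.
Qed.

HB.instance Definition _ := isMeasure.Build _ R R G G0 G_ge0 G_sigma_additive.

Let G_laplace (lambda : R) : 0 <= lambda ->
  (\int[G]_t (expR (- (lambda * t)))%:E = (expR (- (omega * ln (1 + lambda))))%:E)%E.
Proof.
move=> l0.
have s0 : 0 < 1 + lambda by rewrite ltr_pwDl.
have G1 := Gamma_fun_gt0 omega0.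
rewrite (@ge0_integral_lebesgue_density _ _ (`]0, +oo[%classic) (gamma_pdf omega 1))//; last first.
  by apply/measurable_EFinP; apply: measurableT_comp => //; exact: measurableT_comp.
transitivity ((Gamma_fun omega)^-1%:E *
  \int[lebesgue_measure]_(t in `]0%R, +oo[) (t `^ (omega - 1) * expR (- ((1 + lambda) * t)))%:E)%E.
  rewrite -ge0_integralZl_EFin ?invr_ge0 ?(ltW G1)//; last 2 first.
  - by move=> t _; rewrite lee_fin mulr_ge0 ?powR_ge0 ?expR_ge0.
  - apply/measurable_EFinP/measurable_funTS/measurable_funM; first exact: measurable_powR.
    by apply: measurableT_comp => //; apply: measurableT_comp.
  apply: eq_integral => t _; rewrite -!EFinM; congr EFin; rewrite pdfE.
  by rewrite mulrDl mul1r opprD expRD; ring.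
rewrite (gamma_integral_scale omega0 s0) -EFinM mulrA mulVf ?mul1r//.
by rewrite gt_eqF.
Qed.

Let G_setT : G setT = 1%E.
Proof.
have := G_laplace (lexx 0).
under eq_integral do rewrite mul0r oppr0 expR0.
by rewrite integral_cst// mul1e addr0 ln1 mulr0 oppr0 expR0.
Qed.

HB.instance Definition _ := Measure_isProbability.Build _ _ _ G G_setT.

Definition gamma_probability : probability R R := G.

Lemma gamma_probabilityE A : gamma_probability A = gamma_law omega 1 A.
Proof. by []. Qed.

Lemma gamma_probability_neg : gamma_probability `]-oo, 0[%classic = 0%E.
Proof.
rewrite gamma_probabilityE /gamma_law (_ : _ `&` _ = set0) ?integral_set0//.
apply/seteqP; split => // t /= []; rewrite !in_itv/= andbT => t0 t0'.
by have := lt_trans t0 t0'; rewrite ltxx.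
Qed.

Lemma laplace_gamma_probability (lambda : R) : 0 <= lambda ->
  laplace_transform gamma_probability lambda =
  (expR (- (omega * ln (1 + lambda))))%:E.
Proof. exact: G_laplace. Qed.

End gamma_probability.

(** * The Thorin measure of the first passage time *)

Section thorin_primitive.
Context {R : realType} (al be : R).
Hypotheses (al0 : 0 < al) (albe : al <= be).

Let be0 : 0 < be. Proof. exact: lt_le_trans albe. Qed.

Definition log_ratio (u : R) : R := ln (be ^+ 2 + u ^+ 2) - ln (al ^+ 2 + u ^+ 2).

(** Integration by parts: [u] times the derivative of [log_ratio] is [2 al ^ 2 / (al ^ 2 + u ^ 2) -
    2 be ^ 2 / (be ^ 2 + u ^ 2)], whence the arctangents. *)
Definition log_ratio_primitive (u : R) : R :=
  u * log_ratio u + (2 * be * atan (u / be) - 2 * al * atan (u / al)).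

Let sq_gt0 (g u : R) : 0 < g -> 0 < g ^+ 2 + u ^+ 2.
Proof. by move=> g0; rewrite ltr_pwDl ?exprn_gt0 ?sqr_ge0. Qed.

Let is_derive_ln_sq (g u : R) : 0 < g ->
  is_derive u 1 (fun v : R => ln (g ^+ 2 + v ^+ 2)) (2 * u / (g ^+ 2 + u ^+ 2)).
Proof.
move=> g0.
have Hs : is_derive u 1 (fun v : R => v ^+ 2) (u *: 1 + u *: 1).
  exact: (is_deriveM (is_derive_id u 1) (is_derive_id u 1)).
have H : is_derive u 1 (fun v : R => g ^+ 2 + v ^+ 2) (0 + (u *: 1 + u *: 1)).
  exact: is_deriveD.
have Hl : is_derive (g ^+ 2 + u ^+ 2) 1 (@ln R) (g ^+ 2 + u ^+ 2)^-1.
  exact: is_derive1_ln (sq_gt0 u g0).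
have HC := @is_derive1_comp _ (@ln R) (fun v : R => g ^+ 2 + v ^+ 2) _ _ _ Hl H.
apply: is_derive_eq.
change ((g ^+ 2 + u ^+ 2)^-1 * (0 + (u * 1 + u * 1)) = 2 * u / (g ^+ 2 + u ^+ 2)).
by ring.
Qed.

Let is_derive_atan_div (g u : R) : 0 < g ->
  is_derive u 1 (fun v : R => atan (v / g)) (g / (g ^+ 2 + u ^+ 2)).
Proof.
move=> g0.
have H : is_derive u 1 (fun v : R => v / g) g^-1.
  have -> : (fun v : R => v / g) = g^-1 *: id.
    by apply/funext => v; rewrite mulrC.
  by apply: is_derive_eq; exact: mulr1.
have HC := @is_derive1_comp _ (@atan R) (fun v : R => v / g) _ _ _ (is_derive1_atan (u / g)) H.
apply: is_derive_eq; have := sq_gt0 u g0; move=> /lt0r_neq0 s0.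
field; rewrite ?s0 ?gt_eqF//=.
Qed.

Lemma is_derive_log_ratio_primitive (u : R) :
  is_derive u 1 log_ratio_primitive (log_ratio u).
Proof.
have Hb := is_derive_ln_sq u be0; have Ha := is_derive_ln_sq u al0.
have Hab := is_derive_atan_div u be0; have Haa := is_derive_atan_div u al0.
have Hr : is_derive u 1 log_ratio
    (2 * u / (be ^+ 2 + u ^+ 2) - 2 * u / (al ^+ 2 + u ^+ 2)).
  exact: is_deriveB.
have HM : is_derive u 1 (fun v => v * log_ratio v)
  (u *: (2 * u / (be ^+ 2 + u ^+ 2) - 2 * u / (al ^+ 2 + u ^+ 2)) + log_ratio u *: 1).
  exact: (is_deriveM (is_derive_id u 1) Hr).
have HB : is_derive u 1 (fun v => 2 * be * atan (v / be)) ((2 * be) *: (be / (be ^+ 2 + u ^+ 2))).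
  exact: (is_deriveZ (2 * be) Hab).
have HA : is_derive u 1 (fun v => 2 * al * atan (v / al)) ((2 * al) *: (al / (al ^+ 2 + u ^+ 2))).
  exact: (is_deriveZ (2 * al) Haa).
have HG : is_derive u 1 log_ratio_primitive
    ((u *: (2 * u / (be ^+ 2 + u ^+ 2) - 2 * u / (al ^+ 2 + u ^+ 2)) + log_ratio u *: 1)
    + ((2 * be) *: (be / (be ^+ 2 + u ^+ 2)) - (2 * al) *: (al / (al ^+ 2 + u ^+ 2)))).
  by apply: is_deriveD; exact: is_deriveB.
apply: is_derive_eq.
have /lt0r_neq0 b0 := sq_gt0 u be0; have /lt0r_neq0 a0 := sq_gt0 u al0.
change (u * (2 * u / (be ^+ 2 + u ^+ 2) - 2 * u / (al ^+ 2 + u ^+ 2)) + log_ratio u * 1 +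
  (2 * be * (be / (be ^+ 2 + u ^+ 2)) - 2 * al * (al / (al ^+ 2 + u ^+ 2))) = log_ratio u).
field; rewrite ?b0 ?a0//.
Qed.

Lemma log_ratio_primitive0 : log_ratio_primitive 0 = 0.
Proof. by rewrite /log_ratio_primitive !mul0r atan0 !mulr0 subrr addr0. Qed.

(** In this form the ratio is visibly nonincreasing for [u >= 0], and it is the Levy exponent of a
    gamma law of rate [al ^ 2 + u ^ 2]. *)
Lemma log_ratioE u : log_ratio u = ln (1 + (be ^+ 2 - al ^+ 2) / (al ^+ 2 + u ^+ 2)).
Proof.
have a0 := sq_gt0 u al0; have b0 := sq_gt0 u be0.
rewrite /log_ratio -ln_div ?posrE//; congr ln; field.
by rewrite gt_eqF.
Qed.

Lemma log_ratio_ge0 u : 0 <= log_ratio u.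
Proof.
rewrite subr_ge0 ler_ln ?posrE ?sq_gt0// lerD2r.
by rewrite lerXn2r ?nnegrE ?(ltW al0) ?(ltW be0).
Qed.

Lemma log_ratio_le (u v : R) : 0 <= u -> u <= v -> log_ratio v <= log_ratio u.
Proof.
move=> u0 uv; rewrite !log_ratioE.
have p (w : R) : 0 < 1 + (be ^+ 2 - al ^+ 2) / (al ^+ 2 + w ^+ 2).
  rewrite ltr_pwDl// divr_ge0 ?(ltW (sq_gt0 _ al0))// subr_ge0.
  by rewrite lerXn2r ?nnegrE ?(ltW al0) ?(ltW be0).
rewrite ler_ln ?posrE ?p// lerD2l ler_wpM2l//.
  by rewrite subr_ge0 lerXn2r ?nnegrE ?(ltW al0) ?(ltW be0).
rewrite lef_pV2 ?posrE ?sq_gt0// lerD2l.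
by rewrite lerXn2r ?nnegrE// (le_trans u0).
Qed.

Lemma cvg_log_ratio_primitive :
  log_ratio_primitive u @[u --> +oo] --> pi * (be - al).
Proof.
have atan_lim (g : R) : 0 < g ->
    2 * g * atan (u / g) @[u --> +oo] --> 2 * g * (pi / 2).
  move=> g0; apply: cvgM; first exact: cvg_cst.
  apply: (cvg_comp (fun u => u / g) atan _ (@cvgy_atan R)).
  apply/cvgryPge => A; exists (A * g); split; first exact: num_real.
  by move=> u Au; rewrite ler_pdivlMr// ltW.
(* The boundary term is at most [D / u], by [ln (1 + z) <= z]. *)
have L0 : u * log_ratio u @[u --> +oo] --> (0 : R).
  apply/cvgrPdist_le => e e0.
  pose D := be ^+ 2 - al ^+ 2.
  have D0 : 0 <= D by rewrite subr_ge0 lerXn2r ?nnegrE ?(ltW al0) ?(ltW be0).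
  exists (D / e); split; first exact: num_real.
  move=> u Du; have u0 : 0 < u by apply: le_lt_trans Du; rewrite divr_ge0// ltW.
  rewrite sub0r normrN ger0_norm ?mulr_ge0 ?log_ratio_ge0 ?(ltW u0)//.
  have a0 := sq_gt0 u al0.
  apply: (@le_trans _ _ (u * (D / (al ^+ 2 + u ^+ 2)))).
    rewrite ler_pM2l// log_ratioE le_ln1Dx//.
    by apply: (@lt_le_trans _ _ 0); rewrite ?ltrN10// divr_ge0// ltW.
  rewrite mulrA ler_pdivrMr//.
  apply: (@le_trans _ _ (e * u ^+ 2)).
    rewrite expr2 mulrA mulrC ler_pM2r//.
    by rewrite mulrC -ler_pdivrMr// ltW.
  by rewrite ler_pM2l// lerDr sqr_ge0.
rewrite [X in _ --> X](_ : _ = 0 + (2 * be * (pi / 2) - 2 * al * (pi / 2))); last by field.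
apply: cvgD; first exact: L0.
by apply: cvgB; exact: atan_lim.
Qed.

(* Riemann sums of a nonincreasing function, compared with its primitive
   over each step by the mean value theorem. *)
Lemma cvg_riemann_log_ratio :
  (fun n : nat => \sum_(i < (n.+1 ^ 2).+1) log_ratio (i.+1%:R / n.+1%:R) / n.+1%:R)
    @ \oo --> pi * (be - al).
Proof.
pose N (n : nat) : R := n.+1%:R.
have N0 n : 0 < N n by rewrite ltr0n.
pose G := log_ratio_primitive.
have step n i : log_ratio (i.+1%:R / N n) / N n <= G (i.+1%:R / N n) - G (i%:R / N n) <=
                log_ratio (i%:R / N n) / N n.
  have lei : i%:R / N n <= i.+1%:R / N n by rewrite ler_pM2r ?invr_gt0// ler_nat.
  have i0 : 0 <= i%:R / N n by rewrite divr_ge0// ltW.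
  have cG : {within `[i%:R / N n, i.+1%:R / N n], continuous G}.
    apply: derivable_within_continuous => t _.
    by have [] := is_derive_log_ratio_primitive t.
  have [c] := MVT_segment lei (fun t _ => is_derive_log_ratio_primitive t) cG.
  rewrite in_itv/= => /andP[c1 c2] ->.
  have -> : i.+1%:R / N n - i%:R / N n = (N n)^-1.
    by rewrite -mulrBl -natrB// subSnn mul1r.
  by rewrite !ler_pM2r ?invr_gt0// !log_ratio_le// (le_trans i0).
have tele (f : R -> R) (n M : nat) :
    \sum_(i < M) (f (i.+1%:R / N n) - f (i%:R / N n)) = f (M%:R / N n) - f 0.
  elim: M => [|M IH]; first by rewrite big_ord0 mul0r subrr.
  by rewrite big_ord_recr/= IH; ring.
have GE n M : G (M%:R / N n) = \sum_(i < M) (G (i.+1%:R / N n) - G (i%:R / N n)).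
  by rewrite tele /G log_ratio_primitive0 subr0.
have upper n M : \sum_(i < M) log_ratio (i.+1%:R / N n) / N n <= G (M%:R / N n).
  by rewrite GE; apply: ler_sum => i _; have /andP[] := step n i.
(* Left and right sums differ by a telescoping sum, at most [log_ratio 0] times the mesh. *)
have lower n M : G (M%:R / N n) - log_ratio 0 / N n <=
    \sum_(i < M) log_ratio (i.+1%:R / N n) / N n.
  rewrite GE lerBlDr.
  apply: (@le_trans _ _ (\sum_(i < M) log_ratio (i%:R / N n) / N n)).
    by apply: ler_sum => i _; have /andP[] := step n i.
  have -> : \sum_(i < M) log_ratio (i%:R / N n) / N n =
     \sum_(i < M) log_ratio (i.+1%:R / N n) / N n -
     (\sum_(i < M) (log_ratio (i.+1%:R / N n) - log_ratio (i%:R / N n))) / N n.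
    by rewrite mulr_suml -sumrB; apply: eq_bigr => i _; ring.
  rewrite tele lerD2l -mulNr ler_pM2r ?invr_gt0// opprB gerBl.
  exact: log_ratio_ge0.
(* With more than [N ^ 2] steps of length [1 / N] the range exceeds [N]: a single parameter refines
   the mesh and exhausts the half-line. *)
pose U n := ((n.+1 ^ 2).+1)%:R / N n.
have UN n : N n <= U n.
  by rewrite /U ler_pdivlMr// -natrM ler_nat expnS expn1 leqnSn.
have cU : U n @[n --> \oo] --> +oo.
  apply/cvgryPge => A; exists (Num.truncn A) => // n /= An.
  apply: le_trans (UN n); apply: ltW; apply: lt_le_trans (truncnS_gt _) _.
  by rewrite ler_nat ltnS.
have cG : G (U n) @[n --> \oo] --> pi * (be - al).
  exact: (cvg_comp U G cU cvg_log_ratio_primitive).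
apply: (@squeeze_cvgr _ _ _ _ (fun n => G (U n) - log_ratio 0 / N n) (fun n => G (U n))) => //.
  by apply: nearW => n; rewrite lower upper.
rewrite -[X in _ --> X]subr0; apply: cvgB; first exact: cG.
rewrite -[X in _ --> X](mulr0 (log_ratio 0)); apply: cvgM; first exact: cvg_cst.
exact: cvg_harmonic.
Qed.

End thorin_primitive.

(** * The Thorin integral of the passage measure *)

Section thorin_exponent.
Context {R : realType} (a : R).
Hypothesis a0 : 0 < a.
Notation leb := (@lebesgue_measure R).
Let b : R := a ^+ 2 / 2.
Let al : R := a / Num.sqrt 2.

Let sqrt2_gt0 : 0 < Num.sqrt 2 :> R. Proof. by rewrite sqrtr_gt0. Qed.

Let sqrt2_sq : Num.sqrt 2 ^+ 2 = 2 :> R. Proof. by rewrite sqr_sqrtr. Qed.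

Let b_gt0 : 0 < b. Proof. by rewrite divr_gt0// exprn_gt0. Qed.

Let al_gt0 : 0 < al. Proof. by rewrite divr_gt0. Qed.

Let al_sq : al ^+ 2 = b.
Proof. by rewrite /al expr_div_n sqrt2_sq. Qed.

Let be (lambda : R) : R := Num.sqrt (b + lambda).

Let be_sq lambda : 0 <= lambda -> be lambda ^+ 2 = b + lambda.
Proof. by move=> l0; rewrite sqr_sqrtr// addr_ge0// ltW. Qed.

Let al_le_be lambda : 0 <= lambda -> al <= be lambda.
Proof.
move=> l0; rewrite -[leLHS](ger0_norm (ltW al_gt0)) -sqrtr_sqr al_sq.
by rewrite ler_wsqrtr// lerDl.
Qed.

Lemma passage_exponentE (x lambda : R) : 0 <= lambda ->
  passage_exponent a x lambda = Num.sqrt 2 * x / pi * (pi * (be lambda - al)).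
Proof.
move=> l0; rewrite /passage_exponent /al.
have -> : a ^+ 2 + 2 * lambda = 2 * (b + lambda) by rewrite /b; field.
rewrite sqrtrM// -/(be lambda).
have p0 : pi != 0 :> R by rewrite gt_eqF// pi_gt0.
have s0 : Num.sqrt 2 != 0 :> R by rewrite gt_eqF.
have E (p s y : R) : p != 0 -> s != 0 -> x * (s * y - a) = s * x / p * (p * (y - a / s)).
  by move=> p0' s0'; field; rewrite p0' s0'.
exact: E.
Qed.

Let log_ratio_levy (lambda c : R) : 0 <= lambda -> b < c ->
  log_ratio al (be lambda) (Num.sqrt (c - b)) = gamma_levy_exponent c lambda.
Proof.
move=> l0 bc; rewrite log_ratioE//; last exact: al_le_be.
rewrite be_sq// al_sq sqr_sqrtr ?subr_ge0 ?(ltW bc)//.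
by rewrite /gamma_levy_exponent addrAC subrr add0r addrCA subrr addr0.
Qed.

Let levy_ge0 (lambda c : R) : 0 <= lambda -> 0 < c -> 0 <= gamma_levy_exponent c lambda.
Proof. by move=> l0 c0; rewrite ln_ge0// lerDl divr_ge0// ltW. Qed.

Let levy_continuous (lambda c : R) : 0 <= lambda -> 0 < c ->
  {for c, continuous (fun c : R => gamma_levy_exponent c lambda)}.
Proof.
move=> l0 c0; apply: (cvg_comp (fun c => 1 + lambda / c) (@ln R)).
  apply: cvgD; first exact: cvg_cst.
  apply: cvgM; first exact: cvg_cst.
  by apply: cvgV; [rewrite gt_eqF|exact: cvg_id].
by apply: continuous_ln; rewrite ltr_pwDl// divr_ge0// ltW.
Qed.

Let density_continuous (c : R) : b < c -> {for c, continuous (passage_nu_density a)}.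
Proof.
move=> bc; apply: cvgV.
  by rewrite mulf_neq0 ?gt_eqF ?pi_gt0 ?sqrtr_gt0 ?subr_gt0.
apply: cvgM; first exact: cvg_cst.
apply: (cvg_comp (fun c => c - b) Num.sqrt); last exact: sqrt_continuous.
by apply: cvgB; [exact: cvg_id|exact: cvg_cst].
Qed.

Let density_ge0 (c : R) : 0 <= passage_nu_density a c.
Proof. by rewrite invr_ge0 mulr_ge0 ?pi_ge0 ?sqrtr_ge0. Qed.

(* Substituting [c = b + u ^ 2] turns the integrand into [log_ratio]. *)
Let F (lambda c : R) : R :=
  2 / pi * log_ratio_primitive al (be lambda) (Num.sqrt (c - b)).

Let is_derive_F (lambda c : R) : 0 <= lambda -> b < c ->
  is_derive c 1 (F lambda) (gamma_levy_exponent c lambda * passage_nu_density a c).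
Proof.
move=> l0 bc.
have cb0 : 0 < c - b by rewrite subr_gt0.
have H1 : is_derive c 1 (fun c : R => c - b) (1 - 0).
  by apply: is_deriveB; exact: is_derive_cst.
have H2 := @is_derive1_comp _ (@Num.sqrt R) (fun c : R => c - b) _ _ _ (is_derive1_sqrt cb0) H1.
have H3 := @is_derive1_comp _ (log_ratio_primitive al (be lambda)) (fun c : R => Num.sqrt (c - b)) c _ _
  (is_derive_log_ratio_primitive al_gt0 (al_le_be l0) (Num.sqrt (c - b))) H2.
have H4 := is_deriveZ (2 / pi) H3.
apply: is_derive_eq.
change (2 / pi * (log_ratio al (be lambda) (Num.sqrt (c - b)) *
  ((2 * Num.sqrt (c - b))^-1 * (1 - 0))) = gamma_levy_exponent c lambda * passage_nu_density a c).
rewrite log_ratio_levy// /passage_nu_density -/b.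
have p0 : pi != 0 :> R by rewrite gt_eqF// pi_gt0.
have s0 : Num.sqrt (c - b) != 0 by rewrite gt_eqF// sqrtr_gt0.
have E (p s y : R) : p != 0 -> s != 0 -> 2 / p * (y * ((2 * s)^-1 * (1 - 0))) = y * (p * s)^-1.
  by move=> p0' s0'; field; rewrite p0' s0'.
exact: E.
Qed.

Let cvg_F_right (lambda : R) : 0 <= lambda -> F lambda c @[c --> b^'+] --> (0 : R).
Proof.
move=> l0; have -> : 0 = F lambda b.
  by rewrite /F subrr sqrtr0 log_ratio_primitive0 mulr0.
apply: cvg_at_right_filter; apply: cvgM; first exact: cvg_cst.
apply: (cvg_comp (fun c => Num.sqrt (c - b)) (log_ratio_primitive al (be lambda))); last first.
  apply/differentiable_continuous/derivable1_diffP.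
  by have [] := is_derive_log_ratio_primitive al_gt0 (al_le_be l0) (Num.sqrt (b - b)).
apply: (cvg_comp (fun c => c - b) Num.sqrt); last exact: sqrt_continuous.
by apply: cvgB; [exact: cvg_id|exact: cvg_cst].
Qed.

Let cvg_F_pinfty (lambda : R) : 0 <= lambda ->
  F lambda c @[c --> +oo] --> 2 * (be lambda - al).
Proof.
move=> l0; have -> : 2 * (be lambda - al) = 2 / pi * (pi * (be lambda - al)).
  by rewrite mulrA divfK// gt_eqF// pi_gt0.
apply: cvgM; first exact: cvg_cst.
apply: (cvg_comp (fun c => Num.sqrt (c - b)) _ _ (cvg_log_ratio_primitive al_gt0 (al_le_be l0))).
apply/cvgryPge => A; exists (b + A ^+ 2); split; first exact: num_real.
move=> c Ac; rewrite (le_trans (ler_norm A))// -sqrtr_sqr ler_wsqrtr//.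
by rewrite lerBrDl ltW.
Qed.

Lemma integral_levy_density (lambda : R) : 0 <= lambda ->
  (\int[leb]_(c in `]b, +oo[) (gamma_levy_exponent c lambda * passage_nu_density a c)%:E =
   (2 * (be lambda - al))%:E)%E.
Proof.
move=> l0; rewrite -[X in X%:E]subr0.
apply: (ge0_FTC_half_line _ _ _ (cvg_F_right l0) (cvg_F_pinfty l0)) => c bc.
- by rewrite mulr_ge0// levy_ge0// (lt_trans b_gt0).
- apply: cvgM; first by apply: levy_continuous => //; exact: lt_trans bc.
  exact: density_continuous.
- exact: is_derive_F.
Qed.

Let measurable_levy (lambda : R) : 0 <= lambda ->
  measurable_fun (`]0, +oo[%classic : set R) (fun c => (gamma_levy_exponent c lambda)%:E).
Proof.
move=> l0; apply/measurable_EFinP; apply: open_continuous_measurable_fun.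
  exact: interval_open.
by move=> c; rewrite inE/= in_itv/= andbT; exact: levy_continuous.
Qed.

Lemma thorin_exponent_passage (k : {nonneg R}) (lambda : R) : 0 <= lambda ->
  thorin_levy_exponent (mscale k (passage_nu a)) lambda =
  (k%:num * (2 * (be lambda - al)))%:E.
Proof.
move=> l0; rewrite /thorin_levy_exponent.
have L0 c : (`]0, +oo[%classic : set R) c -> (0 <= (gamma_levy_exponent c lambda)%:E)%E.
  by rewrite /= in_itv/= andbT => c0; rewrite lee_fin levy_ge0.
have mI : measurable (`]0, +oo[%classic : set R) by exact: measurable_itv.
rewrite (ge0_integral_mscale _ mI k (measurable_levy l0) L0) EFinM; congr (_ * _)%E.
rewrite integral_mkcond.
have mD : measurable_fun (`]b, +oo[%classic : set R) (passage_nu_density a).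
  apply: open_continuous_measurable_fun; first exact: interval_open.
  by move=> c; rewrite inE/= in_itv/= andbT; exact: density_continuous.
have mbI : measurable (`]b, +oo[%classic : set R) by exact: measurable_itv.
rewrite (ge0_integral_lebesgue_density mbI mD)//; last 2 first.
- by have /(measurable_restrictT _ mI) := measurable_levy l0.
- by move=> c; apply: erestrict_ge0.
rewrite -integral_levy_density//; apply: eq_integral => c.
rewrite inE/= in_itv/= andbT => bc; rewrite patchE mem_set/=; first by rewrite EFinM.
by rewrite in_itv/= andbT (lt_trans b_gt0).
Qed.

Lemma thorin_exponent_first_passage (x lambda : R) (hx : 0 < x) : 0 <= lambda ->
  thorin_levy_exponent
    (mscale (NngNum (divr_ge0 (ltW hx) (sqrtr_ge0 2))) (passage_nu a)) lambda =
  (passage_exponent a x lambda)%:E.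
Proof.
move=> l0; rewrite thorin_exponent_passage// passage_exponentE//=; congr EFin.
have p0 : pi != 0 :> R by rewrite gt_eqF// pi_gt0.
have s0 : Num.sqrt 2 != 0 :> R by rewrite gt_eqF.
rewrite -[X in _ * (X * _) = _]sqrt2_sq.
have E (p s y : R) : p != 0 -> s != 0 -> x / s * (s ^+ 2 * y) = s * x / p * (p * y).
  by move=> p0' s0'; field; rewrite p0' s0'.
exact: E.
Qed.

Lemma passage_nu_neg (k : {nonneg R}) :
  mscale k (passage_nu a) `]-oo, 0]%classic = 0%E.
Proof.
rewrite /mscale/= /passage_nu (_ : _ `&` _ = set0) ?integral_set0 ?mule0//.
apply/seteqP; split => // c /= []; rewrite !in_itv/= andbT => c0 bc.
by have := lt_le_trans (lt_trans b_gt0 bc) c0; rewrite ltxx.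
Qed.

(** From [ln (1 + z) <= z] at [z = - y / (1 + y)], where [1 + z] is the inverse of [1 + y], and then
    [1 + y <= 2]. *)
Lemma half_le_ln1D (y : R) : 0 <= y <= 1 -> y / 2 <= ln (1 + y).
Proof.
move=> /andP[y0 y1]; have d0 : 0 < 1 + y by rewrite ltr_pwDl.
have H : ln (1 + (- (y / (1 + y)))) <= - (y / (1 + y)).
  by rewrite le_ln1Dx// ltrN2 ltr_pdivrMr// mul1r ltrDr.
have E : 1 + (- (y / (1 + y))) = (1 + y)^-1 by field; rewrite gt_eqF.
move: H; rewrite E lnV ?posrE// lerN2; apply: le_trans.
by rewrite ler_wpM2l// lef_pV2 ?posrE// lerD2l.
Qed.

(** For [c >= M] the quotient [M / c] lies in [0, 1], so [1 / c] is at most [2 / M] times the gamma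
    exponent at [lambda = M], whose integral is already known to be finite. *)
Lemma passage_nu_inv_lty (k : {nonneg R}) (M : R) : 0 < M ->
  (\int[mscale k (passage_nu a)]_(c in `[M, +oo[) (c^-1)%:E < +oo)%E.
Proof.
move=> M0.
pose m := mscale k (passage_nu a).
have mM : measurable (`[M, +oo[%classic : set R) by exact: measurable_itv.
have mI : measurable (`]0, +oo[%classic : set R) by exact: measurable_itv.
have sub : (`[M, +oo[%classic : set R) `<=` `]0, +oo[%classic.
  by move=> c /=; rewrite !in_itv/= !andbT; exact: lt_le_trans.
have ml := measurable_levy (ltW M0).
have m2l : measurable_fun (`]0, +oo[%classic : set R)
    (fun c => (2 / M)%:E * (gamma_levy_exponent c M)%:E)%E.
  exact: measurable_funeM.
have L0 c : (`]0, +oo[%classic : set R) c -> (0 <= (gamma_levy_exponent c M)%:E)%E.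
  by rewrite /= in_itv/= andbT => c0; rewrite lee_fin levy_ge0// ltW.
have k0 : 0 <= 2 / M by rewrite divr_ge0// ltW.
apply: (@le_lt_trans _ _ (\int[m]_(c in `]0%R, +oo[) ((2 / M)%:E * (gamma_levy_exponent c M)%:E))%E); last first.
  rewrite ge0_integralZl_EFin//.
  have -> : (\int[m]_(c in `]0%R, +oo[) (gamma_levy_exponent c M)%:E)%E =
     thorin_levy_exponent m M by [].
  by rewrite thorin_exponent_passage ?(ltW M0)// -EFinM ltry.
apply: (@le_trans _ _ (\int[m]_(c in `[M, +oo[) ((2 / M)%:E * (gamma_levy_exponent c M)%:E))%E); last first.
  apply: ge0_subset_integral => // c c0.
  by apply: mule_ge0; [rewrite lee_fin|exact: L0].
apply: ge0_le_integral => //.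
- move=> c; rewrite /= in_itv/= andbT => Mc; rewrite lee_fin invr_ge0.
  exact: le_trans (ltW M0) Mc.
- apply/measurable_EFinP; apply: (measurable_funS mI sub).
  apply: open_continuous_measurable_fun; first exact: interval_open.
  move=> c; rewrite inE/= in_itv/= andbT => c0.
  by apply: cvgV; [rewrite gt_eqF|exact: cvg_id].
- exact: (measurable_funS mI sub).
move=> c; rewrite /= in_itv/= andbT => Mc.
have c0 : 0 < c by exact: lt_le_trans Mc.
rewrite -EFinM lee_fin /gamma_levy_exponent.
apply: (@le_trans _ _ (2 / M * (M / c / 2))).
  rewrite le_eqVlt; apply/orP; left; apply/eqP; field.
  by rewrite !gt_eqF.
rewrite ler_wpM2l// half_le_ln1D// divr_ge0 ?(ltW M0) ?(ltW c0)//=.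
by rewrite ler_pdivrMr// mul1r.
Qed.

(** Each summand is the exponent of a gamma variable of shape [sqrt 2 x / (pi N)] and rate
    [b + u ^ 2], with [u] a right endpoint of the subdivision of mesh [1 / N] and [N = n.+1]. *)
Lemma cvg_riemann_passage (x lambda : R) : 0 <= lambda ->
  (fun n : nat => \sum_(i < (n.+1 ^ 2).+1)
     Num.sqrt 2 * x / pi / n.+1%:R * ln (1 + lambda * (b + (i.+1%:R / n.+1%:R) ^+ 2)^-1))
    @ \oo --> passage_exponent a x lambda.
Proof.
move=> l0; rewrite passage_exponentE//.
rewrite [X in X @ _ --> _](_ : _ = fun n : nat => Num.sqrt 2 * x / pi *
   \sum_(i < (n.+1 ^ 2).+1) log_ratio al (be lambda) (i.+1%:R / n.+1%:R) / n.+1%:R).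
  apply: cvgM; first exact: cvg_cst.
  exact: (cvg_riemann_log_ratio al_gt0 (al_le_be l0)).
apply/funext => n; rewrite mulr_sumr; apply: eq_bigr => i _.
rewrite log_ratioE ?al_le_be// be_sq// al_sq (addrAC b) subrr add0r.
by rewrite -!mulrA; congr (_ * (_ * (_ * _))); rewrite mulrC.
Qed.

End thorin_exponent.

(** * Gamma approximation and infinite divisibility of the passage law *)

Section first_passage_ggc.
Context {R : realType} (a x : R) (mu : probability R R).
Hypotheses (a0 : 0 < a) (x0 : 0 < x).
Hypothesis mu0 : mu `]-oo, 0[%classic = 0%E.
Hypothesis mu_laplace : forall lambda, 0 <= lambda ->
  laplace_transform mu lambda = (expR (- passage_exponent a x lambda))%:E.

Let K : R := Num.sqrt 2 * x / pi.

Let K_gt0 : 0 < K.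
Proof. by rewrite divr_gt0 ?pi_gt0// mulr_gt0// sqrtr_gt0. Qed.

Let omega (n : nat) : R := K / n.+1%:R.

Let omega_gt0 n : 0 < omega n. Proof. by rewrite divr_gt0. Qed.

Let weight (n : nat) (i : 'I_(n.+1 ^ 2).+1) : R :=
  (a ^+ 2 / 2 + (i.+1%:R / n.+1%:R) ^+ 2)^-1.

Let weight_gt0 n i : 0 < @weight n i.
Proof.
by rewrite invr_gt0 ltr_pwDl ?sqr_ge0// divr_gt0// exprn_gt0.
Qed.

Let gamma_sum (n : nat) : exists nu : probability R R,
  [/\ finite_gamma_convolution nu, nu `]-oo, 0[%classic = 0%E &
      forall lambda, 0 <= lambda -> laplace_transform nu lambda =
        (expR (- \sum_(i < (n.+1 ^ 2).+1) omega n * ln (1 + lambda * @weight n i)))%:E].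
Proof.
have [d [T [P [X [nu [indX lawX lawS nu0 Lnu]]]]]] :=
  laplace_weighted_sum (m := fun=> gamma_probability (omega_gt0 n)) (@weight_gt0 n)
    (fun=> gamma_probability_neg (omega_gt0 n)).
exists nu; split => //.
  exists (n.+1 ^ 2)%N, d, T, P, X, (@weight n), (fun=> omega n), (fun=> 1).
  by split => // i; rewrite weight_gt0 omega_gt0.
move=> lambda l0; rewrite Lnu -sumrN expR_sum prode_fin; apply: eq_bigr => i _.
by rewrite laplace_gamma_probability// mulr_ge0// ltW.
Qed.

Lemma first_passage_generalized_gamma_convolution : generalized_gamma_convolution mu.
Proof.
pose nu n := sval (cid (gamma_sum n)).
have nuP n := svalP (cid (gamma_sum n)).
exists nu; split; first by move=> n; have [] := nuP n.
apply: laplace_weakly_converges => //; first by move=> n; have [] := nuP n.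
move=> i; rewrite mu_laplace//=.
have -> : (fun n => fine (laplace_transform (nu n) i%:R)) = fun n =>
    expR (- \sum_(j < (n.+1 ^ 2).+1) omega n * ln (1 + i%:R * @weight n j)).
  by apply/funext => n; have [_ _ ->] := nuP n.
apply: (cvg_comp _ expR); last exact: continuous_expR.
have /cvgN H := cvg_riemann_passage (x := x) a0 (ler0n R i).
exact: H.
Qed.

(** The convolution root of order [n.+1] is the passage law at level [x / n.+1%:R]. Its existence is
    a premise here, so that the section deals with laws only and not with Brownian paths. *)
Lemma first_passage_infinitely_divisible :
  (forall n : nat, exists nu : probability R R,
    nu `]-oo, 0[%classic = 0%E /\
    forall lambda, 0 <= lambda ->
      laplace_transform nu lambda = (expR (- passage_exponent a (x / n.+1%:R) lambda))%:E) ->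
  infinitely_divisible mu.
Proof.
move=> H n; have [nu [nu0 Lnu]] := H n.
have [d [T [P [X [S [indX lawX lawS S0 LS]]]]]] :=
  laplace_weighted_sum (m := fun=> nu) (fun i : 'I_n.+1 => ltr01) (fun=> nu0).
exists d, T, P, X; split => //.
  move=> i j; split; first exact: measurable_funP.
  move=> A mA; have [_ ->//] := lawX i.
  by have [_ /(_ A mA)] := lawX j.
have SE : (fun w => \sum_(i < n.+1) X i w) = (fun w => \sum_(i < n.+1) 1 * X i w).
  by apply/funext => w; apply: eq_bigr => i _; rewrite mul1r.
rewrite SE; case: lawS => mS lawS; split => // A mA; rewrite lawS//.
apply: laplace_unique => // i; rewrite LS mu_laplace//.
under eq_bigr do rewrite mulr1 Lnu//.
rewrite -prode_fin -expR_sum sumrN big_const_ord iter_addr_0; congr (expR (- _))%:E.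
by rewrite -[LHS]mulr_natr /passage_exponent mulrAC divfK// pnatr_eq0.
Qed.

End first_passage_ggc.

Theorem mainTheorem2 (R : realType) (d : measure_display)
    (T : measurableType d) (P : probability T R) (B : R -> {RV P >-> R})
    (hB : standard_brownian_motion B)
    (a x : R) (ha : 0 < a) (hx : 0 < x) :
  exists mu : probability R R,
    has_law P (first_passage_time B a x) (pushforward mu (@EFin R)) /\
    ggc_with_thorin_measure mu
      (mscale (NngNum (divr_ge0 (ltW hx) (sqrtr_ge0 2))) (passage_nu a)).
Proof.
have [mu [law_mu mu0 Lmu]] := first_passage_lawP hB ha hx.
exists mu; split => //; split.
  exact: (first_passage_generalized_gamma_convolution ha hx mu0 Lmu).
split.
- exact: passage_nu_neg.
- by move=> M M0; exact: passage_nu_inv_lty.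
- apply: (first_passage_infinitely_divisible mu0 Lmu) => n.
  have xn : 0 < x / n.+1%:R by rewrite divr_gt0.
  by have [nu [_ nu0 Lnu]] := first_passage_lawP hB ha xn; exists nu.
- by move=> lambda l0; rewrite Lmu// thorin_exponent_first_passage.
Qed.
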